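(* Let $\mathcal{H}$ be a real Hilbert space, $A:\mathcal{H}\rightrightarrows\mathcal{H}$ a maximally monotone operator, and $B:\mathcal{H}\to\mathcal{H}$ a monotone and $\frac1\beta$-Lipschitz continuous operator with $\beta>0$. For $\gamma>0$ and $x\in\mathcal{H}$ put $$f(\gamma,x) := J_{\gamma A}(x-\gamma Bx) - x + \gamma Bx - \gamma B\big(J_{\gamma A}(x-\gamma Bx)\big).$$ Let $\gamma:[0,+\infty)\to(0,\beta)$ be (Lebesgue) measurable. Then, for each $x_0\in\mathcal{H}$, there exists a unique function $x:[0,+\infty)\to\mathcal{H}$ with $x(0)=x_0$ which is locally absolutely continuous and satisfies $\dot x(t)=f(\gamma(t),x(t))$ for almost every $t\in[0,+\infty)$.
   Context: $J_{\gamma A}=(\mathrm{Id}+\gamma A)^{-1}$ is the resolvent of $\gamma A$ (single-valued and defined on all of $\mathcal{H}$ for $\gamma>0$). A function $x:[0,b]\to\mathcal{H}$ is absolutely continuous if there is an integrable $y:[0,b]\to\mathcal{H}$ with $x(t)=x(0)+\int_0^t y(s)\,ds$ for all $t\in[0,b]$; then $\dot x=y$ almost everywhere. A function on $[0,+\infty)$ is locally absolutely continuous if it is absolutely continuous on $[0,b]$ for every $0<b<+\infty$. *)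

(* Defs.v *)
From HB Require Import structures.
From mathcomp Require Export all_boot all_order all_algebra.
From mathcomp Require Export all_classical all_reals all_analysis.

Set Implicit Arguments.
Unset Strict Implicit.
Unset Printing Implicit Defensive.

Export Order.TTheory GRing.Theory Num.Def Num.Theory.
Export numFieldNormedType.Exports.

#[export] Set Implicit Arguments.
#[export] Unset Strict Implicit.
#[export] Unset Printing Implicit Defensive.

Local Open Scope classical_set_scope.
Local Open Scope ring_scope.

(* [R] with the Lebesgue (not merely Borel) sigma-algebra, the domain of
   [completed_lebesgue_measure]; see [completed_caratheodory_measurable]. *)
Notation lebesgueType R := (caratheodory_type (mu_ext (@wlength R idfun))).

Section operators.
Context {R : realType} {H : completeNormedModType R}.
Implicit Types (ip : {dot H for idfun}) (A : H -> set H) (B : H -> H).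

Definition monotone_rel ip A : Prop :=
  forall x y u v, A x u -> A y v -> 0 <= ip (x - y) (u - v).

Definition maximally_monotone ip A : Prop :=
  monotone_rel ip A /\
  forall A', monotone_rel ip A' -> (forall x, A x `<=` A' x) ->
    forall x, A' x `<=` A x.

Definition monotone_fun ip B : Prop :=
  forall x y, 0 <= ip (x - y) (B x - B y).

Definition scale_rel (g : R) A : H -> set H := fun x => [set g *: u | u in A x].

(* [(Id + A)^-1 x]; the default [0] is taken only if this set is empty, which
   does not happen when [A] is maximally monotone (Minty), in which case the set
   is a singleton. *)
Definition resolvent A (x : H) : H := xget 0 [set p | [set p + u | u in A p] x].

Definition fbf_field A B (g : R) (x : H) : H :=
  let p := resolvent (scale_rel g A) (x - g *: B x) in
  p - x + g *: B x - g *: B p.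

End operators.

(* The Bochner integral, for a complete measure [mu]: completeness and the
   almost everywhere convergence make [`|y t - s n t|] measurable. *)
Section bochner.
Context {d : measure_display} {T : measurableType d} {R : realType}
  {H : completeNormedModType R}.
Variables (mu : {measure set T -> \bar R}) (D : set T).

Definition simple_integrable (s : T -> H) : Prop :=
  [/\ finite_set (range s),
      forall h, measurable (s @^-1` [set h]) &
      forall h, h != 0 -> (mu (D `&` s @^-1` [set h]) < +oo)%E].

Definition simple_integral (s : T -> H) : H :=
  \sum_(h \in range s) fine (mu (D `&` s @^-1` [set h])) *: h.

Definition bochner_approx (y : T -> H) (s : nat -> T -> H) : Prop :=
  [/\ forall n, simple_integrable (s n),
      {ae mu, forall t, D t -> s n t @[n --> \oo] --> y t} &
      (\int[mu]_(t in D) (`|y t - s n t|)%:E)%E @[n --> \oo] --> 0%E].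

Definition bochner_integrable (y : T -> H) : Prop := exists s, bochner_approx y s.

Definition bochner_integral (y : T -> H) : H :=
  xget 0 [set v | exists2 s, bochner_approx y s &
                  simple_integral (s n) @[n --> \oo] --> v].

End bochner.

Section absolute_continuity.
Context {R : realType} {H : completeNormedModType R}.

Definition absolutely_continuous (b : R) (x : R -> H) : Prop :=
  exists2 y : lebesgueType R -> H,
    bochner_integrable completed_lebesgue_measure `[0, b] y &
    forall t, 0 <= t <= b ->
      x t = x 0 + bochner_integral completed_lebesgue_measure `[0, t] y.

Definition locally_absolutely_continuous (x : R -> H) : Prop :=
  forall b, 0 < b -> absolutely_continuous b x.

(* Functions on [0, +oo[ are represented by total functions on [R] whose values
   on the negative reals are irrelevant: [{0}] is negligible, so the two-sided
   derivative is only constrained at points [0 < t]. *)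
Definition strong_solution (f : R -> H -> H) (g : R -> R) (x0 : H)
    (x : R -> H) : Prop :=
  [/\ x 0 = x0,
      locally_absolutely_continuous x &
      {ae @completed_lebesgue_measure R, forall t, 0 <= t ->
        is_derive (t : R^o) (1 : R^o) (x : R^o -> H) (f (g t) (x t))}].

End absolute_continuity.

(* Main.v *)
(* Minty's theorem makes the resolvents everywhere defined; it is obtained by
   minimising [r + (|x|^2 + |u|^2) / 2] over the epigraph of the Fitzpatrick
   function of [A], where minimising sequences are Cauchy by the parallelogram
   identity. As resolvents are nonexpansive, the field [f c x] is Lipschitz in
   [x] uniformly in [c]; for fixed [x] it is bounded and continuous in [c].

   Hence [t |-> f (gamma t) (x t)] is Bochner integrable on bounded intervals
   whenever [x] is locally Lipschitz, and Picard iteration converges in the norm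
   weighted by [exp (2 K t)], in which integrating a [K]-Lipschitz field is a
   contraction of factor 1/2. Lebesgue differentiation for Bochner integrals
   turns the integral equation into the differential one and back; the same
   weighted estimate gives uniqueness. *)

Require Import Defs.
From mathcomp Require finmap.
From mathcomp Require Import measurable_realfun ring lra.

Local Open Scope classical_set_scope.
Local Open Scope ring_scope.

(** * Minty's theorem *)

(** The obstacle is the composite [t |-> f (gamma t) (x t)]: [gamma] is merely Lebesgue measurable
    and [H] may be nonseparable, so measurability has to be exhibited by explicit simple maps. They
    come from rounding [gamma t] and [t] to finite grids. For parameters [c] near 0, the bounds on
    the resolvent come from comparison with one fixed point of the graph of [A], because such a
    point is a resolvent value for every [c] simultaneously.

    The weight satisfies [\int_0^t exp (2 K u) <= exp (2 K t) / (2 K)], so a factor [K] in front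
    leaves 1/2 on the whole half-line at once. The Picard iterates are made to share a local
    Lipschitz bound, because the field along their limit must again be integrable. A competing
    solution is only known to be absolutely continuous, so the uniqueness argument starts from an
    integral bound instead.

    Before differentiation, Lebesgue measurable functions are exchanged for Borel ones off a null
    set. *)

Section inner_product.
Context {R : realType} {H : completeNormedModType R} (ip : {dot H for idfun}).
Hypothesis ip_norm : forall u : H, ip u u = `|u| ^+ 2.
Implicit Types u v w : H.

Lemma ipC u v : ip u v = ip v u.
Proof. by rewrite hermC expr0 mul1r. Qed.

Lemma ipDr w u v : ip w (u + v) = ip w u + ip w v.
Proof. by rewrite raddfD. Qed.

Lemma ipZr w a v : ip w (a *: v) = a * ip w v.
Proof. by rewrite linearZ. Qed.

Lemma ipNr w v : ip w (- v) = - ip w v.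
Proof. by rewrite raddfN. Qed.

Lemma ipDl w u v : ip (u + v) w = ip u w + ip v w.
Proof. by rewrite ipC ipDr !(ipC w). Qed.

Lemma ipZl w a v : ip (a *: v) w = a * ip v w.
Proof. by rewrite ipC ipZr (ipC w). Qed.

Lemma ipNl w v : ip (- v) w = - ip v w.
Proof. by rewrite ipC ipNr (ipC w). Qed.

Lemma ip0l w : ip 0 w = 0.
Proof. by rewrite -(scale0r 0) ipZl mul0r. Qed.

Definition ipE := (ipDr, ipDl, ipNr, ipNl, ipZr, ipZl).

Lemma ip_ge0 u : 0 <= ip u u.
Proof. by rewrite ip_norm exprn_ge0. Qed.

Lemma ip_eq0 u : ip u u = 0 -> u = 0.
Proof. by rewrite ip_norm => /eqP; rewrite sqrf_eq0 normr_eq0 => /eqP. Qed.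

Lemma ip_le_norm u v : ip u v <= `|u| * `|v|.
Proof.
have [->|u0] := eqVneq u 0; first by rewrite ip0l normr0 mul0r.
have [->|v0] := eqVneq v 0; first by rewrite ipC ip0l normr0 mulr0.
have := ip_ge0 (`|v| *: u - `|u| *: v).
rewrite !ipE !ip_norm (ipC v u) => h.
have : 0 < `|u| * `|v| by rewrite mulr_gt0 ?normr_gt0.
move: (`|u|) (`|v|) (ip u v) h => a b c h ab.
rewrite -(ler_pM2l ab); nra.
Qed.

Lemma normr_ip_le u v : `|ip u v| <= `|u| * `|v|.
Proof.
by rewrite ler_norml ip_le_norm andbT lerNl -ipNl (le_trans (ip_le_norm _ _))// normrN.
Qed.

(** Testing with [v := u] suffices. This turns bounds on weak integrals into norm bounds. *)
Lemma norm_le_ip u (c : R) : 0 <= c -> (forall v, ip u v <= c * `|v|) -> `|u| <= c.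
Proof.
move=> c0 /(_ u); rewrite ip_norm expr2.
have [->|u0] := eqVneq u 0; first by rewrite normr0.
by rewrite ler_pM2r ?normr_gt0.
Qed.

(** Vector identities are proved below by testing against [w]: they become scalar identities, which
    [ring] decides. *)
Lemma ip_ext u v : (forall w, ip u w = ip v w) -> u = v.
Proof.
move=> h; apply/eqP; rewrite -subr_eq0; apply/eqP/ip_eq0.
by rewrite ipDl ipNl h subrr.
Qed.

Lemma cvg_ip (u : nat -> H) l w : u n @[n --> \oo] --> l ->
  ip (u n) w @[n --> \oo] --> ip l w.
Proof.
move=> ul; apply/cvgrPdist_le => e e0.
have w1 : 0 < `|w| + 1 by rewrite ltr_wpDl.
have : 0 < e / (`|w| + 1) by rewrite divr_gt0.
move/cvgrPdist_le : ul => /[apply]; apply: filterS => n.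
rewrite ler_pdivlMr// => h; rewrite -ipNl -ipDl.
rewrite (le_trans (normr_ip_le _ _))// (le_trans _ h)// ler_wpM2l// lerDl//.
Qed.

End inner_product.

Section cauchy_sequences.
Context {R : realType} {H : completeNormedModType R}.

(** One Cauchy criterion for three uses: minimising sequences, integrals of simple maps, Picard
    iterates. *)
Lemma cvg_of_dist_le (u : nat -> H) (e : nat -> R) :
  e n @[n --> \oo] --> 0 -> (forall n m, `|u n - u m| <= e n + e m) ->
  cvg (u n @[n --> \oo]).
Proof.
move=> e0 ue; apply/cauchy_cvgP/cauchy_exP => eps eps0.
have : 0 < eps / 4 by rewrite divr_gt0.
move/cvgrPdist_le : e0 => /[apply] -[N _ hN]; exists (u N).
exists N => // n Nn /=; rewrite -ball_normE/=.
have := hN N (leqnn N); have := hN n Nn; have := ue N n; rewrite /= !sub0r !normrN.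
have := ler_norm (e N); have := ler_norm (e n); lra.
Qed.

End cauchy_sequences.

Section minty.
Context {R : realType} {H : completeNormedModType R} (ip : {dot H for idfun}).
Hypothesis ip_norm : forall u : H, ip u u = `|u| ^+ 2.
Variables (A : H -> set H) (A_max : maximally_monotone ip A).

(** Adding the single pair [(x, u)] to the graph keeps it monotone, so by maximality the pair was
    there already. *)
Lemma maximally_monotone_mem x u :
  (forall y v, A y v -> 0 <= ip (x - y) (u - v)) -> A x u.
Proof.
move=> xu; have [A_mono maxA] := A_max.
apply: (maxA (fun y => A y `|` [set v | y = x /\ v = u])) => [|y v|]; last 2 first.
- by left.
- by right.
move=> y y' v v' [Ayv|[-> ->]] [Ay'v'|[-> ->]].
- exact: A_mono.
- by rewrite -(opprB x) -(opprB u) ipNl ipNr opprK xu.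
- exact: xu.
- by rewrite !subrr ip0l.
Qed.

(* The epigraph of the Fitzpatrick function of [A]. *)
Let C x u (r : R) := forall y v, A y v -> ip x v + ip y u - ip y v <= r.

(** The Fitzpatrick function dominates the pairing: if [r < ip x u], the pair is monotonically
    related to the whole graph, hence lies in [A], and then [C] tested at the pair itself gives a
    contradiction. *)
Let C_ge x u r : C x u r -> ip x u <= r.
Proof.
move=> Cxu; rewrite leNgt; apply/negP => rxu.
suff Axu : A x u by have := Cxu _ _ Axu; lra.
apply: maximally_monotone_mem => y v /Cxu; rewrite !ipE; lra.
Qed.

Let phi x u (r : R) := r + (ip x x + ip u u) / 2.

(** By [C_ge], [phi x u r] is at least half of [ip (x + u) (x + u)]. *)
Let phi_ge0 x u r : C x u r -> 0 <= phi x u r.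
Proof.
move=> /C_ge; have := ip_ge0 ip_norm (x + u); rewrite !ipE (ipC ip u x) /phi; lra.
Qed.

(** [C] is an intersection of half-spaces. Midpoints ([t = 1/2]) make minimising sequences Cauchy;
    small [t] gives the first-order condition at the minimiser. *)
Let C_conv x u r y v s (t : R) : 0 <= t <= 1 -> C x u r -> C y v s ->
  C (x + t *: (y - x)) (u + t *: (v - u)) (r + t * (s - r)).
Proof.
move=> t01 Cx Cy p q Apq; have := Cx _ _ Apq; have := Cy _ _ Apq.
rewrite !ipE; nra.
Qed.

(** By monotonicity the Fitzpatrick function is at most the pairing on the graph; these points are
    the competitors for the minimiser. *)
Let C_mem y v : A y v -> C y v (ip y v).
Proof. by move=> Ayv p q /(A_max.1 _ _ _ _ Ayv); rewrite !ipE; lra. Qed.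

Let minimizer : exists x u r, C x u r /\
  forall y v s, C y v s -> phi x u r <= phi y v s.
Proof.
pose S := [set a | exists x u r, C x u r /\ a = phi x u r].
have lbS : lbound S 0 by move=> _ [x [u [r [Cx ->]]]]; exact: phi_ge0.
(* The empty relation is not maximal: with no pair to test against, the membership criterion puts
   [(0, 0)] in it. *)
have [y0 [v0 Ayv0]] : exists y v, A y v.
  apply: contrapT => nA; apply: (nA); exists 0, 0; apply: maximally_monotone_mem.
    by move=> y v Ayv; exfalso; apply: nA; exists y, v.
have S0 : S !=set0.
  by exists (phi y0 v0 (ip y0 v0)), y0, v0, (ip y0 v0); split=> //; exact: C_mem.
have hS : has_inf S by split => //; exists 0.
pose m := inf S.
have mle x u r : C x u r -> m <= phi x u r.
  by move=> Cx; apply: ge_inf; [exists 0|exists x, u, r].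
(* The error is a square so that the distances below become linear in [n.+1%:R^-1]. *)
have seq n : {p : H * H * R | C p.1.1 p.1.2 p.2 /\
    phi p.1.1 p.1.2 p.2 < m + n.+1%:R^-1 ^+ 2}.
  apply: cid; have e0 : 0 < n.+1%:R^-1 ^+ 2 :> R by rewrite exprn_gt0// invr_gt0.
  have [_ [x [u [r [Cx ->]]]] lt] := inf_adherent e0 hS.
  by exists (x, u, r).
pose x n := (sval (seq n)).1.1; pose u n := (sval (seq n)).1.2.
pose r n := (sval (seq n)).2.
have Cn n : C (x n) (u n) (r n) by rewrite /x /u /r; case: (seq n) => ? [].
have pn n : phi (x n) (u n) (r n) < m + n.+1%:R^-1 ^+ 2.
  by rewrite /x /u /r; case: (seq n) => ? [].
(* The midpoint has [phi] equal to the average minus one eighth of the left-hand side, and is still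
   at least [m]; this gives the factor 4. *)
have par n k : ip (x n - x k) (x n - x k) + ip (u n - u k) (u n - u k) <=
    4 * (n.+1%:R^-1 ^+ 2 + k.+1%:R^-1 ^+ 2).
  have h : 0 <= (2^-1 : R) <= 1 by lra.
  have := mle _ _ _ (@C_conv _ _ _ _ _ _ _ h (Cn n) (Cn k)); have := pn n; have := pn k.
  rewrite /phi !ipE (ipC ip (x k) (x n)) (ipC ip (u k) (u n)).
  move: (n.+1%:R^-1 ^+ 2) (k.+1%:R^-1 ^+ 2) (ip (x n) (x n)) => a b c; lra.
pose e n : R := 2 * n.+1%:R^-1.
have e_cvg : e n @[n --> \oo] --> 0.
  rewrite -[X in _ --> X](mulr0 2); apply: cvgM; first exact: cvg_cst.
  exact: cvg_harmonic.
have sq (a b c : R) : 0 <= b -> 0 <= c -> a ^+ 2 <= 4 * (b ^+ 2 + c ^+ 2) -> 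
    a <= 2 * b + 2 * c.
  move=> b0 c0 h; rewrite leNgt; apply/negP => lt; nra.
have inv0 n : 0 <= n.+1%:R^-1 :> R by rewrite invr_ge0.
have xc : cvg (x n @[n --> \oo]).
  apply: (cvg_of_dist_le e_cvg) => n k; apply: sq => //; rewrite -ip_norm.
  by rewrite (le_trans _ (par n k))// lerDl ip_ge0.
have uc : cvg (u n @[n --> \oo]).
  apply: (cvg_of_dist_le e_cvg) => n k; apply: sq => //; rewrite -ip_norm.
  by rewrite (le_trans _ (par n k))// lerDr ip_ge0.
pose x' := lim (x n @[n --> \oo]); pose u' := lim (u n @[n --> \oo]).
(* The third component is the one for which [phi] equals [m]. Only membership in [C] remains, and
   each of its inequalities passes to the limit. *)
exists x', u', (m - (ip x' x' + ip u' u') / 2); split; last first.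
  by move=> y v s /mle; rewrite [phi x' _ _]/phi subrK.
move=> y v Ayv.
have c1 : ip (x n) v + ip y (u n) - ip y v @[n --> \oo] --> ip x' v + ip y u' - ip y v.
  apply: cvgB; last exact: cvg_cst.
  apply: cvgD; first exact: cvg_ip.
  by rewrite ipC; under eq_fun do rewrite ipC; exact: cvg_ip.
have c2 : m + n.+1%:R^-1 * n.+1%:R^-1 - (`|x n| * `|x n| + `|u n| * `|u n|) / 2 @[n --> \oo]
    --> m + 0 * 0 - (`|x'| * `|x'| + `|u'| * `|u'|) / 2.
  apply: cvgB.
    apply: cvgD; first exact: cvg_cst.
    by apply: cvgM; exact: cvg_harmonic.
  apply: cvgM; last exact: cvg_cst.
  by apply: cvgD; apply: cvgM; exact: cvg_norm.
rewrite mul0r addr0 -!expr2 -!ip_norm in c2.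
apply: ler_cvg_to c1 c2 _; near=> n.
have := Cn n _ _ Ayv; have := pn n; rewrite /phi !ip_norm !expr2.
by move: (n.+1%:R^-1) => a; lra.
Unshelve. all: by end_near. Qed.

(** The first-order condition at the minimiser is [key]. It makes [(- u, - x)] monotonically related
    to the graph, hence a member of [A]; inserting this pair in [key] forces [x + u = 0]. *)
Lemma minty0 : exists x, A x (- x).
Proof.
have [x [u [r [Cx min]]]] := minimizer.
have key y v : A y v -> ip (x + u) (x + u) <= ip (y + u) (v + x).
  move=> Ayv.
  have h (t : R) : 0 < t -> t <= 1 -> 0 <= (ip y v - r) + ip x (y - x) + ip u (v - u)
     + t * ((ip (y - x) (y - x) + ip (v - u) (v - u)) / 2).
    move=> t0 t1; have t01 : 0 <= t <= 1 by rewrite (ltW t0).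
    have := min _ _ _ (@C_conv _ _ _ _ _ _ _ t01 Cx (C_mem Ayv)).
    rewrite -(pmulr_rge0 _ t0) /phi !ipE (ipC ip y x) (ipC ip v u); nra.
  have : 0 <= (ip y v - r) + ip x (y - x) + ip u (v - u).
    (* This lets [t] tend to 0 in [0 <= a + t * b]. If [a < 0], the chosen [t] makes [t * b] at most
       [- a / 2], a contradiction. *)
    move: (_ + ip u _) ((_ + _) / 2) h => a b h.
    rewrite leNgt; apply/negP => a0.
    have b1 : 0 < `|b| + 1 by rewrite ltr_wpDl.
    pose c := - a / 2 / (`|b| + 1); pose t := Num.min 1 c.
    have tc : t <= c by rewrite /t ge_min lexx orbT.
    have t1 : t <= 1 by rewrite /t ge_min lexx.
    have t0 : 0 < t by rewrite /t lt_min ltr01/= !divr_gt0// oppr_gt0.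
    have cb : c * (`|b| + 1) = - a / 2 by rewrite /c divfK// gt_eqF.
    have := h _ t0 t1; have := ler_norm b; nra.
  have := C_ge Cx; rewrite !ipE (ipC ip u x) (ipC ip y x); lra.
have Aux : A (- u) (- x).
  apply: maximally_monotone_mem => y v /key.
  have := ip_ge0 ip_norm (x + u); rewrite -!opprD ipNl ipNr opprK.
  by rewrite (addrC u) (addrC x v); lra.
have := key _ _ Aux; rewrite addNr ip0l => le0.
have /(ip_eq0 ip_norm)/eqP : ip (x + u) (x + u) = 0.
  by apply/eqP; rewrite eq_le le0 ip_ge0.
by rewrite addr_eq0 => /eqP xu; exists x; rewrite {1}xu.
Qed.

End minty.

(** * The forward-backward-forward field *)

Section resolvent.
Context {R : realType} {H : completeNormedModType R} (ip : {dot H for idfun}).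
Hypothesis ip_norm : forall u : H, ip u u = `|u| ^+ 2.

(** The relation is [x |-> g A x - w]. A point [p] whose image under it contains [- p] solves the
    inclusion [w \in p + g A p]. *)
Lemma maximally_monotone_scale_sub (A : H -> set H) (g : R) (w : H) : 0 < g ->
  maximally_monotone ip A ->
  maximally_monotone ip (fun x => [set v | A x (g^-1 *: (v + w))]).
Proof.
move=> g0 A_max; split.
  move=> x y u v Axu Ayv; have := A_max.1 _ _ _ _ Axu Ayv.
  rewrite -scalerBr ipZr opprD addrACA subrr addr0 pmulr_rge0 ?invr_gt0//.
move=> A' A'_mono AA' x u A'xu; apply: (maximally_monotone_mem A_max) => y v Ayv.
have A'y : A' y (g *: v - w).
  by apply: AA' => /=; rewrite subrK scalerA mulVf ?gt_eqF// scale1r.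
have := A'_mono _ _ _ _ A'xu A'y; rewrite opprB addrA => h.
by rewrite -(pmulr_rge0 _ g0) -ipZr scalerBr scalerA divff ?gt_eqF// scale1r.
Qed.

Lemma minty (A : H -> set H) (g : R) (w : H) : 0 < g ->
  maximally_monotone ip A -> exists p u, A p u /\ p + g *: u = w.
Proof.
move=> g0 /(maximally_monotone_scale_sub w g0) /(minty0 ip_norm)[p /= Apu].
exists p, (g^-1 *: (- p + w)); split => //.
by rewrite scalerA divff ?gt_eqF// scale1r addrA subrr add0r.
Qed.

(** Pairing the difference of the two sums with [p - p'] gives the squared norm of [p - p'] plus a
    term that is nonnegative by monotonicity; Cauchy-Schwarz concludes. *)
Lemma resolvent_unique_le (A : H -> set H) (g : R) p u p' u' : 0 <= g ->
  monotone_rel ip A -> A p u -> A p' u' ->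
  `|p - p'| <= `|(p + g *: u) - (p' + g *: u')|.
Proof.
move=> g0 A_mono Apu Apu'.
have [->|pp'] := eqVneq p p'; first by rewrite subrr normr0.
rewrite -(@ler_pM2l _ `|p - p'|) ?normr_gt0 ?subr_eq0//.
apply: le_trans (ip_le_norm ip_norm _ _); rewrite -expr2 -ip_norm.
have := A_mono _ _ _ _ Apu Apu'; rewrite opprD addrACA -scalerBr (ipDr _ _ (p - p')) ipZr.
by move=> /(mulr_ge0 g0); lra.
Qed.

Section resolvent_maximal.
Variables (A : H -> set H) (A_max : maximally_monotone ip A).
Local Notation J g := (resolvent (scale_rel g A)).

Lemma resolventP g w : 0 < g -> exists2 u, A (J g w) u & J g w + g *: u = w.
Proof.
move=> g0; have [p [u [Apu puw]]] := minty w g0 A_max.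
have Jw : [set p | [set p + u | u in scale_rel g A p] w] (J g w).
  by apply: xgetPex; exists p, (g *: u) => //; exists u.
by case: Jw => _ [u' Au' <-] Jw; exists u'.
Qed.

Lemma resolvent_nonexpansive g w w' : 0 < g -> `|J g w - J g w'| <= `|w - w'|.
Proof.
move=> g0; have [u Au uw] := resolventP w g0; have [u' Au' uw'] := resolventP w' g0.
rewrite -{2}uw -{2}uw'; exact: (resolvent_unique_le (ltW g0) A_max.1 Au Au').
Qed.

(** A graph pair satisfies [p = J g (p + g *: u)] for all [g] at once, so one pair yields estimates
    that are uniform in [g]. *)
Lemma resolvent_dist_graph g w p u : 0 < g -> A p u ->
  `|J g w - p| <= `|w - p - g *: u|.
Proof.
move=> g0 Apu; have [v Av vw] := resolventP w g0.
rewrite -addrA -opprD -{2}vw; exact: (resolvent_unique_le (ltW g0) A_max.1 Av Apu).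
Qed.

(** The graph pair used is the one at [J g w] itself: then [w - p - g' *: u] is [(g - g') *: u], and
    [K] is the norm of [u]. *)
Lemma resolvent_param g w : 0 < g -> exists K, forall g', 0 < g' ->
  `|J g' w - J g w| <= K * `|g' - g|.
Proof.
move=> g0; have [u Au uw] := resolventP w g0.
exists `|u| => g' g'0; apply: le_trans (resolvent_dist_graph w g'0 Au) _.
by rewrite -{1}uw (addrC (J g w)) addrK -scalerBl normrZ mulrC distrC.
Qed.

End resolvent_maximal.

Section fbf_field.
Variables (A : H -> set H) (A_max : maximally_monotone ip A).
Variables (B : H -> H) (beta : R).
Hypotheses (beta_gt0 : 0 < beta) (B_lip : (beta^-1).-lipschitz B).
Local Notation F := (fbf_field A B).
Local Notation J g := (resolvent (scale_rel g A)).

Let dom (g : R) := 0 < g < beta.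

(** Since [g < beta], the map [g *: B] is nonexpansive. *)
Let dist_scale_B g x y : dom g -> `|g *: B x - g *: B y| <= `|x - y|.
Proof.
move=> /andP[g0 gb]; rewrite -scalerBr normrZ gtr0_norm//.
apply: le_trans (_ : beta * (beta^-1 * `|x - y|) <= _); last first.
  by rewrite mulrA divff ?gt_eqF// mul1r.
apply: ler_pM => //; [exact: ltW|exact: ltW|].
by have := @B_lip (x, y) (conj Logic.I Logic.I).
Qed.

Let dist_forward g x y : dom g ->
  `|(x - g *: B x) - (y - g *: B y)| <= 2 * `|x - y|.
Proof.
move=> dg; have -> : x - g *: B x - (y - g *: B y) = (x - y) - (g *: B x - g *: B y).
  by apply: (ip_ext ip_norm) => w; rewrite !ipE; ring.
have := ler_normB (x - y) (g *: B x - g *: B y); have := dist_scale_B x y dg; lra.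
Qed.

(** The forward step [x - g *: B x] costs a factor 2 and the resolvent none. So the four terms of
    the field contribute 2 + 1 + 1 + 2 = 6. *)
Lemma fbf_field_lipschitz g x y : 0 < g < beta -> `|F g x - F g y| <= 6 * `|x - y|.
Proof.
move=> dg; rewrite /fbf_field/=; set p := J g _; set q := J g _.
have pq : `|p - q| <= 2 * `|x - y|.
  by rewrite (le_trans _ (dist_forward _ _ dg))// (resolvent_nonexpansive A_max)//; case/andP: dg.
have -> : p - x + g *: B x - g *: B p - (q - y + g *: B y - g *: B q) =
  (p - q) + ((g *: B x - g *: B y) - ((x - y) + (g *: B p - g *: B q))).
  by apply: (ip_ext ip_norm) => w; rewrite !ipE; ring.
have := ler_normD (p - q) ((g *: B x - g *: B y) - ((x - y) + (g *: B p - g *: B q))).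
have := ler_normB (g *: B x - g *: B y) ((x - y) + (g *: B p - g *: B q)).
have := ler_normD (x - y) (g *: B p - g *: B q).
have := dist_scale_B p q dg; have := dist_scale_B x y dg; lra.
Qed.

Lemma fbf_field_bounded x : exists M, forall g, 0 < g < beta -> `|F g x| <= M.
Proof.
(* Any graph point serves as reference. It is fixed before [g], which keeps the bound uniform. *)
have [p [u [Apu _]]] := minty 0 (ltr01 : 0 < 1 :> R) A_max.
exists (2 * (2 * `|x - p| + beta * (`|B p| + `|u|)) + 2 * `|x - p|).
move=> g /andP[g0 gb]; have dg : dom g by rewrite /dom g0.
rewrite /fbf_field/=; set w := x - _; set q := J g w.
have wp : `|w - p| <= 2 * `|x - p| + beta * `|B p|.
  have -> : w - p = (w - (p - g *: B p)) - g *: B p.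
    by apply: (ip_ext ip_norm) => v; rewrite !ipE; ring.
  rewrite (le_trans (ler_normB _ _))// lerD ?dist_forward//.
  by rewrite normrZ gtr0_norm// ler_wpM2r// ltW.
have gu : `|g *: u| <= beta * `|u| by rewrite normrZ gtr0_norm// ler_wpM2r// ltW.
have qp : `|q - p| <= 2 * `|x - p| + beta * (`|B p| + `|u|).
  apply: le_trans (resolvent_dist_graph A_max w g0 Apu) _.
  by have := ler_normB (w - p) (g *: u); lra.
have -> : q - x + g *: B x - g *: B q =
    (q - p) - ((x - p) - (g *: B x - g *: B p) + (g *: B q - g *: B p)).
  by apply: (ip_ext ip_norm) => v; rewrite !ipE; ring.
have := ler_normB (q - p) ((x - p) - (g *: B x - g *: B p) + (g *: B q - g *: B p)).
have := ler_normD ((x - p) - (g *: B x - g *: B p)) (g *: B q - g *: B p).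
have := ler_normB (x - p) (g *: B x - g *: B p).
have := dist_scale_B q p dg; have := dist_scale_B x p dg; lra.
Qed.

Lemma fbf_field_param g x : 0 < g < beta -> exists K, forall g', 0 < g' < beta ->
  `|F g' x - F g x| <= K * `|g' - g|.
Proof.
move=> dg; have [g0 gb] := andP dg.
have [K hK] := resolvent_param A_max (x - g *: B x) g0.
set p := J g (x - g *: B x) in hK.
exists (2 * (`|B x| + K) + `|B x| + `|B p|) => g' dg'.
have [g'0 g'b] := andP dg'.
rewrite /fbf_field/= -/p; set p' := J g' _.
(* The parameter acts twice, through the point where the resolvent is evaluated and through its
   index; the two changes are made one after the other. *)
have pp : `|p' - p| <= (`|B x| + K) * `|g' - g|.
  have -> : p' - p = (p' - J g' (x - g *: B x)) + (J g' (x - g *: B x) - p).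
    by rewrite addrA subrK.
  rewrite (le_trans (ler_normD _ _))// mulrDl lerD ?hK//.
  apply: le_trans (resolvent_nonexpansive A_max _ _ g'0) _.
  have -> : x - g' *: B x - (x - g *: B x) = (g - g') *: B x.
    by apply: (ip_ext ip_norm) => v; rewrite !ipE; ring.
  by rewrite normrZ mulrC distrC.
have -> : p' - x + g' *: B x - g' *: B p' - (p - x + g *: B x - g *: B p) =
    (p' - p) - ((g' *: B p' - g' *: B p) + ((g' - g) *: B p - (g' - g) *: B x)).
  by apply: (ip_ext ip_norm) => v; rewrite !ipE; ring.
have := ler_normB (p' - p)
  ((g' *: B p' - g' *: B p) + ((g' - g) *: B p - (g' - g) *: B x)).
have := ler_normD (g' *: B p' - g' *: B p) ((g' - g) *: B p - (g' - g) *: B x).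
have := ler_normB ((g' - g) *: B p) ((g' - g) *: B x).
rewrite !normrZ; have := dist_scale_B p' p dg'; lra.
Qed.

End fbf_field.
End resolvent.

(** * Bochner integrals *)

Section simple_maps.
Context {d : measure_display} {T : measurableType d}.

(** Values may lie in any type: the integrands are built below by pairing and decoding maps into
    [option nat]. *)
Definition simple_map {V : Type} (s : T -> V) :=
  finite_set (range s) /\ forall v, measurable (s @^-1` [set v]).

Lemma simple_map_preimage {V : Type} (s : T -> V) (Y : set V) :
  simple_map s -> measurable (s @^-1` Y).
Proof.
move=> [fs ms]; rewrite (_ : _ @^-1` _ = \bigcup_(v in range s `&` Y) s @^-1` [set v]).
  by apply: fin_bigcup_measurable => [|v _]; [exact: finite_setIl|exact: ms].
by apply/seteqP; split => [t Yt|t [v [_ Yv] /= ->//]]; exists (s t) => //; split => //; exists t.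
Qed.

Lemma simple_map_measurable {V : Type} {d'} {U : measurableType d'} (s : T -> V)
  (phi : V -> U) D : simple_map s -> measurable D -> measurable_fun D (phi \o s).
Proof.
move=> hs mD _ Y _; apply: measurableI => //; rewrite comp_preimage.
exact: simple_map_preimage.
Qed.

Lemma simple_map_comp {V W : Type} (s : T -> V) (phi : V -> W) :
  simple_map s -> simple_map (phi \o s).
Proof.
move=> hs; split.
  by have := finite_image phi hs.1; rewrite image_comp.
by move=> w; rewrite comp_preimage; exact: simple_map_preimage.
Qed.

Lemma simple_map_pair {V W : Type} (s : T -> V) (r : T -> W) :
  simple_map s -> simple_map r -> simple_map (fun t => (s t, r t)).
Proof.
move=> [fs ms] [fr mr]; split.
  apply: (sub_finite_set _ (finite_setX fs fr)) => _ [t _ <-].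
  by split; exists t.
move=> [v w]; rewrite (_ : _ @^-1` _ = s @^-1` [set v] `&` r @^-1` [set w]).
  exact: measurableI.
by apply/seteqP; split => t /= [-> ->].
Qed.

End simple_maps.

Section strong_measurability.
Context {d : measure_display} {T : measurableType d} {R : realType}
  {H : completeNormedModType R} (mu : {measure set T -> \bar R}).
Hypothesis mu_complete : measure_is_complete mu.

(** Limits of simple maps are stable under differences in every [H], whereas Borel measurability
    need not be when [H] is nonseparable. *)
Definition strongly_measurable (D : set T) (y : T -> H) :=
  exists2 s : nat -> T -> H, forall n, simple_map (s n) &
    {ae mu, forall t, D t -> s n t @[n --> \oo] --> y t}.

(** Off the exceptional set [N] the limit is pointwise; completeness of [mu] then allows arbitrary
    values on [N]. *)
Lemma ae_cvg_measurable (D : set T) (f_ : nat -> T -> R) (f : T -> R) :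
  measurable D -> (forall n, measurable_fun D (f_ n)) ->
  {ae mu, forall t, D t -> f_ n t @[n --> \oo] --> f t} -> measurable_fun D f.
Proof.
move=> mD mf_ [N [mN N0 subN]].
have mfN : measurable_fun D (f \_ (D `\` N)).
  apply: (@measurable_fun_cvg _ _ _ _ (fun n => f_ n \_ (D `\` N))) => [n|t Dt].
    apply: (measurable_funS measurableT) => //.
    apply/(measurable_restrictT _ (measurableD mD mN)).
    by apply: measurable_funS (mf_ n).
  rewrite patchE; under eq_fun do rewrite patchE.
  case: ifPn => [/set_mem[_ Nt]|_]; last exact: cvg_cst.
  by apply: contrapT => h; apply/Nt/subN => /(_ Dt).
apply/measurable_EFinP.
apply: (ae_measurable_fun mu_complete) (_ : measurable_fun D (EFin \o f \_ (D `\` N))).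
  exists N; split => // t /= h; apply: contrapT => Nt; apply: h => Dt.
  by rewrite patchE mem_set.
exact/measurable_EFinP.
Qed.

Lemma strongly_measurable_comp (D : set T) (y : T -> H) (phi : H -> R) :
  measurable D -> continuous phi -> strongly_measurable D y ->
  measurable_fun D (phi \o y).
Proof.
move=> mD cphi [s hs sy]; apply: (@ae_cvg_measurable D (fun n => phi \o s n)) => //.
  by move=> n; exact: simple_map_measurable.
by move: sy; apply: filterS => t + Dt => /(_ Dt); exact: (continuous_cvg _ (cphi _)).
Qed.

Lemma strongly_measurableB (D : set T) (y z : T -> H) :
  strongly_measurable D y -> strongly_measurable D z ->
  strongly_measurable D (y \- z).
Proof.
move=> [s hs sy] [r hr rz]; exists (fun n => s n \- r n).
  move=> n; exact: (simple_map_comp (fun p => p.1 - p.2) (simple_map_pair (hs n) (hr n))).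
move: sy rz; apply: filterS2 => t sy rz Dt; exact: cvgB (sy Dt) (rz Dt).
Qed.

Lemma simple_map_strongly_measurable (D : set T) (s : T -> H) :
  simple_map s -> strongly_measurable D s.
Proof. by move=> hs; exists (fun=> s) => //; apply: aeW => t _; exact: cvg_cst. Qed.

Lemma strongly_measurable_cst (D : set T) (v : H) : strongly_measurable D (fun=> v).
Proof.
apply: simple_map_strongly_measurable; split.
  by apply: (sub_finite_set _ (finite_set1 v)) => _ [t _ <-].
move=> w; have [->|vw] := eqVneq v w.
  by rewrite (_ : _ @^-1` _ = setT)//; apply/seteqP; split.
rewrite (_ : _ @^-1` _ = set0)//; apply/seteqP; split => // t /= vw'.
by rewrite vw' eqxx in vw.
Qed.

Lemma strongly_measurable_norm (D : set T) (y : T -> H) : measurable D ->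
  strongly_measurable D y -> measurable_fun D (fun t => `|y t|).
Proof.
by move=> mD /(strongly_measurable_comp mD) h; apply: (h Num.norm); exact: norm_continuous.
Qed.

Lemma strongly_measurableS (D E : set T) (y : T -> H) : D `<=` E ->
  strongly_measurable E y -> strongly_measurable D y.
Proof. by move=> DE [s hs sy]; exists s => //; move: sy; apply: filterS => t h /DE. Qed.

End strong_measurability.

Section almost_everywhere.
Context {d : measure_display} {T : measurableType d} {R : realType}
  (mu : {measure set T -> \bar R}).

(* [filterS] and [filterS2], whose [Filter] instance is not found for
   [completed_lebesgue_measure]. *)
Lemma ae_imply (P Q : T -> Prop) : (forall t, P t -> Q t) ->
  {ae mu, forall t, P t} -> {ae mu, forall t, Q t}.
Proof. exact: filterS. Qed.

Lemma ae_imply2 (P Q S : T -> Prop) : (forall t, P t -> Q t -> S t) ->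
  {ae mu, forall t, P t} -> {ae mu, forall t, Q t} -> {ae mu, forall t, S t}.
Proof. exact: filterS2. Qed.

End almost_everywhere.

(* Testing against [h] reduces the Bochner integral to scalar Lebesgue
   integrals: [v] is the weak integral of [y] if [ip v h] is the integral of
   [ip (y t) h] for all [h]. *)
Section weak_integral.
Context {d : measure_display} {T : measurableType d} {R : realType}
  {H : completeNormedModType R} (ip : {dot H for idfun}).
Hypothesis ip_norm : forall u : H, ip u u = `|u| ^+ 2.
Variable mu : {measure set T -> \bar R}.
Hypothesis mu_complete : measure_is_complete mu.
Variables (D : set T) (mD : measurable D).

(** The condition in Bochner's criterion. It is the working notion because it passes to differences
    and subsets without choosing approximations. *)
Definition norm_integrable (y : T -> H) :=
  strongly_measurable mu D y /\ mu.-integrable D (fun t => (`|y t|)%:E).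

Lemma ip_continuous (h : H) : continuous (fun u => ip u h).
Proof.
move=> u; apply/cvgrPdist_le => e e0.
have h1 : 0 < `|h| + 1 by rewrite ltr_wpDl.
have eh : 0 < e / (`|h| + 1) by rewrite divr_gt0.
near=> v; rewrite -ipNl -ipDl (le_trans (normr_ip_le ip_norm _ _))//.
have : `|u - v| <= e / (`|h| + 1).
  by near: v; apply: cvgr_dist_le eh; exact: cvg_id.
rewrite ler_pdivlMr// => h2; rewrite (le_trans _ h2)// ler_wpM2l// lerDl//.
Unshelve. all: by end_near. Qed.

Lemma norm_integrableB y z : norm_integrable y -> norm_integrable z ->
  norm_integrable (y \- z).
Proof.
move=> [my iy] [mz iz]; split; first exact: strongly_measurableB.
apply: (@le_integrable _ _ _ mu D mD _ (fun t => (`|y t|)%:E + (`|z t|)%:E)%E).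
- by apply/measurable_EFinP/(strongly_measurable_norm mu_complete mD); exact: strongly_measurableB.
- by move=> t _; rewrite -EFinD !abse_EFin lee_fin normr_id ger0_norm ?addr_ge0// ler_normB.
- exact: integrableD.
Qed.

Lemma ip_integrable y h : norm_integrable y ->
  mu.-integrable D (fun t => (ip (y t) h)%:E).
Proof.
move=> [my iy].
apply: (@le_integrable _ _ _ mu D mD _ (fun t => (`|h|)%:E * (`|y t|)%:E)%E).
- apply/measurable_EFinP.
  exact: (strongly_measurable_comp mu_complete mD (ip_continuous (h := h))).
- move=> t _; rewrite -EFinM !abse_EFin lee_fin (le_trans (normr_ip_le ip_norm _ _))//.
  by rewrite mulrC ler_norm.
- exact: integrableZl.
Qed.

Definition weak_integral (y : T -> H) (v : H) :=
  forall h, ip v h = \int[mu]_(t in D) ip (y t) h.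

Lemma weak_integralB y z v w : norm_integrable y -> norm_integrable z ->
  weak_integral y v -> weak_integral z w -> weak_integral (y \- z) (v - w).
Proof.
move=> iy iz yv zw h; rewrite ipDl ipNl yv zw -RintegralB//; first last.
- exact: ip_integrable.
- exact: ip_integrable.
by apply: eq_Rintegral => t _; rewrite /= ipDl ipNl.
Qed.

Lemma weak_integral_norm y v : norm_integrable y -> weak_integral y v ->
  `|v| <= \int[mu]_(t in D) `|y t|.
Proof.
move=> iy yv; apply: (norm_le_ip ip_norm); first exact: Rintegral_ge0.
move=> h; rewrite yv mulrC -RintegralZl//; last exact: iy.2.
apply: le_Rintegral => //; first exact: ip_integrable.
  by have := integrableZl mD `|h| iy.2.
by move=> t _; rewrite mulrC ip_le_norm.
Qed.

Hypothesis D_fin : (mu D < +oo)%E.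

Lemma simple_norm_integrable s : simple_map s -> norm_integrable s.
Proof.
move=> hs; split; first exact: simple_map_strongly_measurable.
apply: measurable_bounded_integrable => //.
  exact: (simple_map_measurable (fun h : H => `|h| : R) hs mD).
have [X rX] : exists X : seq H, range s = [set` X].
  by have [X ->] := (finite_seqP _).1 hs.1; exists X.
exists (\sum_(x <- X) `|x|); split => [|M hM]; first exact: num_real.
move=> t _ /=; rewrite normr_id (le_trans _ (ltW hM))//.
have sX : s t \in X.
  by have : range s (s t) by [exists t]; rewrite rX.
by rewrite (big_rem _ sX)/= lerDl sumr_ge0.
Qed.

Import finmap.

Lemma simple_weak_integral s : simple_map s -> weak_integral s (simple_integral mu D s).
Proof.
move=> hs h; have fs := hs.1.
pose E v := s @^-1` [set v].
have mE v : measurable (E v) by exact: hs.2.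
have iI v : mu.-integrable D (EFin \o \1_(E v)).
  apply: measurable_bounded_integrable => //.
  exists 1; split => [|M]; first exact: num_real.
  move=> M1 t _ /=; rewrite indicE ger0_norm ?ler0n//.
  by rewrite (le_trans _ (ltW M1))// lern1 leq_b1.
have iE v : mu.-integrable D (EFin \o (fun t => ip v h * \1_(E v) t)).
  exact: (integrableZl mD (ip v h) (iI v)).
have intE v : \int[mu]_(t in D) (ip v h * \1_(E v) t) = ip v h * fine (mu (D `&` E v)).
  by rewrite (RintegralZl _ mD (iI v)) /Rintegral integral_indic// setIC.
rewrite /simple_integral /Rintegral.
(* At each [t] only the value [v = s t] contributes, so the integrand is a finite combination of
   indicators of fibres. *)
rewrite (_ : (fun t => _) = fun t =>
    (\sum_(v <- fset_set (range s)) (ip v h * \1_(E v) t)%:E)%E); last first.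
  apply/funext => t; rewrite sumEFin; congr EFin.
  rewrite (big_fsetD1 (s t)) /=; last by rewrite in_fset_set// mem_set//; exists t.
  rewrite big1_fset ?addr0; last first.
    move=> v; rewrite !inE => /andP[vs _] _; rewrite indicE memNset ?mulr0//.
    by move=> /= e; rewrite e eqxx in vs.
  by rewrite indicE mem_set ?mulr1.
rewrite integral_sum// fsbig_finite//=.
transitivity (\sum_(v <- fset_set (range s)) ip (fine (mu (D `&` E v)) *: v) h).
  elim/big_rec2 : _ => [|v a b _ <-]; first by rewrite ip0l.
  by rewrite ipDl.
rewrite -sum_fine; last by move=> v _; exact: integrable_fin_num (iE v).
by apply: eq_bigr => v _; rewrite ipZl mulrC -intE.
Qed.

End weak_integral.

Section norm_integrable.
Context {d : measure_display} {T : measurableType d} {R : realType}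
  {H : completeNormedModType R} (mu : {measure set T -> \bar R}).
Hypothesis mu_complete : measure_is_complete mu.

Lemma norm_integrableS (D E : set T) (y : T -> H) : measurable D -> measurable E ->
  D `<=` E -> norm_integrable mu E y -> norm_integrable mu D y.
Proof.
move=> mD mE DE [my iy]; split; first exact: strongly_measurableS my.
exact: integrableS iy.
Qed.

Lemma Rintegral_norm_subset (D E : set T) (y : T -> H) :
  measurable D -> measurable E -> D `<=` E -> norm_integrable mu E y ->
  \int[mu]_(t in D) `|y t| <= \int[mu]_(t in E) `|y t|.
Proof.
move=> mD mE DE hy; rewrite /Rintegral fine_le//.
- by apply: integrable_fin_num => //; exact: (norm_integrableS mD mE DE hy).2.
- by apply: integrable_fin_num => //; exact: hy.2.
- apply: (ge0_subset_integral mu mD mE) => //.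
  by have /integrableP[] := hy.2.
Qed.

Lemma norm_integrable_cst (D : set T) (v : H) : measurable D -> (mu D < +oo)%E ->
  norm_integrable mu D (fun=> v).
Proof.
move=> mD finD; split; first exact: strongly_measurable_cst.
by apply/integrableP; split => //; rewrite integral_cst//= lte_mul_pinfty.
Qed.

End norm_integrable.

(** * Bochner integrals are weak integrals *)

Section bochner_weak.
Context {d : measure_display} {T : measurableType d} {R : realType}
  {H : completeNormedModType R} (ip : {dot H for idfun}).
Hypothesis ip_norm : forall u : H, ip u u = `|u| ^+ 2.
Variable mu : {measure set T -> \bar R}.
Hypothesis mu_complete : measure_is_complete mu.
Variables (D : set T) (mD : measurable D).
Hypothesis D_fin : (mu D < +oo)%E.

Lemma bochner_approx_simple_map y s n : bochner_approx mu D y s -> simple_map (s n : T -> H).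
Proof. by move=> [/(_ n)[]]. Qed.

Lemma bochner_approx_norm_integrable (y : T -> H) s : bochner_approx mu D y s ->
  norm_integrable mu D y.
Proof.
move=> ys; have [_ sy int0] := ys.
have my : strongly_measurable mu D y.
  by exists s => // n; exact: bochner_approx_simple_map ys.
split=> //.
(* Convergence to 0 makes the distances eventually finite, so one simple map at finite distance from
   [y] is enough. *)
have /fine_cvgP[[N _ fin] _] := int0.
have hN := simple_norm_integrable mD D_fin (bochner_approx_simple_map N ys).
have iyN : mu.-integrable D (fun t => (`|y t - s N t|)%:E).
  apply/integrableP; split.
    apply/measurable_EFinP/(strongly_measurable_norm mu_complete mD).
    exact: strongly_measurableB my hN.1.
  under eq_integral do rewrite abse_EFin normr_id.
  by rewrite -ge0_fin_numE ?integral_ge0//; exact: (fin N (leqnn N)).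
apply: (@le_integrable _ _ _ mu D mD _ (fun t => (`|y t - s N t|)%:E + (`|s N t|)%:E)%E).
- exact/measurable_EFinP/(strongly_measurable_norm mu_complete mD).
- move=> t _; rewrite -EFinD !abse_EFin lee_fin normr_id ger0_norm ?addr_ge0//.
  by rewrite -{1}(subrK (s N t) (y t)) ler_normD.
- by apply: integrableD => //; exact: hN.2.
Qed.

Let dist (y : T -> H) (s : nat -> T -> H) n := \int[mu]_(t in D) `|y t - s n t|.

Let dist_cvg0 (y : T -> H) s : bochner_approx mu D y s -> dist y s n @[n --> \oo] --> 0.
Proof. by move=> [_ _ /fine_cvgP[]]. Qed.

(** The integrals of [s n] and [s m] differ by at most the integrated distances of both maps to [y];
    the bound goes through the weak integral of the difference. *)
Let simple_cvg (y : T -> H) s : bochner_approx mu D y s ->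
  cvg (simple_integral mu D (s n) @[n --> \oo]).
Proof.
move=> ys; apply: (cvg_of_dist_le (dist_cvg0 ys)) => n m.
have iy := bochner_approx_norm_integrable ys.
have hs k := bochner_approx_simple_map k ys.
have is_ k := simple_norm_integrable mD D_fin (hs k).
have iB k := norm_integrableB mu_complete mD iy (is_ k).
have ws k := simple_weak_integral ip mD D_fin (hs k).
have isB := norm_integrableB mu_complete mD (is_ n) (is_ m).
apply: le_trans (weak_integral_norm ip_norm mu_complete mD isB _) _.
  exact: weak_integralB.
rewrite /dist -RintegralD//; [|exact: (iB n).2|exact: (iB m).2].
apply: le_Rintegral => //; first exact: isB.2.
  by have := integrableD mD (iB n).2 (iB m).2.
move=> t _ /=; rewrite -(normrN (y t - s n t)) (le_trans _ (ler_normD _ _))//.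
by rewrite opprB addrA subrK.
Qed.

(** A weak integral is determined by its pairings, so the limit does not depend on the approximating
    sequence, and the choice made by [xget] in [bochner_integral] is harmless. *)
Let simple_cvg_weak (y : T -> H) s v : bochner_approx mu D y s ->
  simple_integral mu D (s n) @[n --> \oo] --> v -> weak_integral ip mu D y v.
Proof.
move=> ys sv h.
have iy := bochner_approx_norm_integrable ys.
have hs k := bochner_approx_simple_map k ys.
have is_ k := simple_norm_integrable mD D_fin (hs k).
have iB k := norm_integrableB mu_complete mD iy (is_ k).
have ws k := simple_weak_integral ip mD D_fin (hs k).
have c1 := cvg_ip ip_norm (w := h) sv.
suff c2 : ip (simple_integral mu D (s n)) h @[n --> \oo] --> \int[mu]_(t in D) ip (y t) h.
  exact: (@cvg_unique _ (@Rhausdorff R) _ _ _ _ c1 c2).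
under eq_fun do rewrite ws.
have ub : `|h| * dist y s n @[n --> \oo] --> 0.
  by rewrite -[X in _ --> X](mulr0 `|h|); apply: cvgM; [exact: cvg_cst|exact: dist_cvg0].
apply/cvgrPdist_le => e e0; move/cvgrPdist_le : ub => /(_ _ e0); apply: filterS => n.
rewrite sub0r normrN ger0_norm ?mulr_ge0 ?Rintegral_ge0//; apply: le_trans.
have iip z : norm_integrable mu D z -> mu.-integrable D (fun t => (ip (z t) h)%:E).
  exact: ip_integrable.
rewrite -RintegralB//; [|exact: iip iy|exact: iip (is_ n)].
have -> : \int[mu]_(t in D) (ip (y t) h - ip (s n t) h) =
    \int[mu]_(t in D) (ip ((y \- s n) t) h).
  by apply: eq_Rintegral => t _; rewrite ipDl ipNl.
rewrite (le_trans (le_normr_Rintegral mD (iip _ (iB n))))//.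
rewrite /dist -RintegralZl//; last exact: (iB n).2.
apply: le_Rintegral => //.
- by have := integrable_norm (iip _ (iB n)).
- by have := integrableZl mD `|h| (iB n).2.
- by move=> t _; rewrite mulrC normr_ip_le.
Qed.

Lemma bochner_integrable_norm (y : T -> H) :
  bochner_integrable mu D y -> norm_integrable mu D y.
Proof. by move=> [s /bochner_approx_norm_integrable]. Qed.

Lemma bochner_integralP (y : T -> H) : bochner_integrable mu D y ->
  weak_integral ip mu D y (bochner_integral mu D y).
Proof.
move=> [s ys].
suff [s' ys'] : [set v | exists2 s, bochner_approx mu D y s &
    simple_integral mu D (s n) @[n --> \oo] --> v] (bochner_integral mu D y).
  exact: simple_cvg_weak.
apply: xgetPex; exists (lim (simple_integral mu D (s n) @[n --> \oo])).
by exists s => //; exact: simple_cvg ys.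
Qed.

Lemma bochner_integrableS (E : set T) (y : T -> H) : measurable E -> E `<=` D ->
  bochner_integrable mu D y -> bochner_integrable mu E y.
Proof.
move=> mE ED [s ys]; have [ss sy int0] := ys; exists s; split.
- move=> n; have [fs ms lt] := ss n; split => // h /lt; apply: le_lt_trans.
  by rewrite le_measure ?inE//; [exact: measurableI|exact: measurableI|exact: setSI].
- by move: sy; apply: filterS => t h /ED.
- apply: (squeeze_cvge _ (cvg_cst 0%E) int0); apply: nearW => n.
  rewrite integral_ge0//=; apply: ge0_subset_integral => //.
  apply/measurable_EFinP/(strongly_measurable_norm mu_complete mD).
  apply: strongly_measurableB (bochner_approx_norm_integrable ys).1 _.
  exact: simple_map_strongly_measurable (bochner_approx_simple_map n ys).
Qed.

End bochner_weak.

(** * Lebesgue differentiation *)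

Section lebesgue_borel.
Context {R : realType}.
Local Notation mu := (@completed_lebesgue_measure R).
Local Notation L := (lebesgueType R).
Local Notation BR := (measurableTypeR R).

Lemma completed_lebesgue_measureE (E : set R) : mu E = lebesgue_measure (E : set BR).
Proof. by []. Qed.

Lemma borel_lebesgue_measurable (E : set R) :
  measurable (E : set BR) -> measurable (E : set L).
Proof. exact: sub_caratheodory. Qed.

Lemma lebesgue_itv_measurable (i : interval R) : measurable ([set` i] : set L).
Proof. by apply: borel_lebesgue_measurable; exact: measurable_itv. Qed.

(** The Lebesgue sigma-algebra is the completion of the Borel one: [E] is [B] together with a subset
    of the null set [N]. *)
Lemma lebesgue_borel_inner (E : set R) : measurable (E : set L) ->
  exists B N : set R, [/\ measurable (B : set BR), measurable (N : set BR),
    lebesgue_measure (N : set BR) = 0%E, B `<=` E & E `<=` B `|` N].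
Proof.
move=> mE.
have : (completed_algebra_gen (@lebesgue_measure R)).-sigma.-measurable E.
  by rewrite completed_caratheodory_measurable.
rewrite g_sigma_completed_algebra_genE => -[B mB [N' [N [mN N0 NN']] <-]].
exists B, N; split => //.
exact: setUS.
Qed.

(** The superlevel sets at rational levels determine [f]. Each is Borel up to a null set, and the
    union of these countably many null sets is removed. *)
Lemma lebesgue_borel_measurable_fun (f : R -> R) :
  measurable_fun setT (f : L -> R) ->
  exists M : set R, [/\ measurable (M : set BR), lebesgue_measure (M : set BR) = 0%E &
    measurable_fun (~` M : set BR) (f : BR -> R)].
Proof.
move=> mf.
(* An enumeration of the rationals; indices that code nothing give 0, which only repeats a level. *)
pose q n : R := ratr (odflt 0 (unpickle n : option rat)).
have mE n : measurable (f @^-1` `]q n, +oo[ : set L).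
  by rewrite -[X in measurable X]setTI; apply: mf => //; exact: measurable_itv.
have /choice[B /choice[N BN]] := fun n => lebesgue_borel_inner (mE n).
have mN n : measurable (N n : set BR) by case: (BN n).
have mM : measurable (\bigcup_n N n : set BR) by exact: bigcupT_measurable.
exists (\bigcup_n N n); split => //.
  apply/eqP; rewrite -measure_le0.
  rewrite (le_trans (measure_sigma_subadditive _ mN mM _))//.
  by rewrite eseries0// => n _ _; case: (BN n).
move=> mC; apply: (measurability _ (RGenOInfty.measurableE R)) => //= _ [_ [x ->] <-].
rewrite (_ : _ `&` _ = \bigcup_(n in [set n | x < q n]) (~` (\bigcup_n N n) `&` B n)).
  apply: bigcup_measurable => n _; apply: measurableI => //; by case: (BN n).
apply/seteqP; split => t /=.
  rewrite in_itv/= andbT => -[Mt xf].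
  have [p] := rat_in_itvoo xf; rewrite in_itv/= => /andP[xp pf].
  have qp : q (pickle p) = ratr p by rewrite /q pickleK.
  exists (pickle p); first by rewrite /= qp.
  split => //; have [_ _ _ _] := BN (pickle p).
  move=> /(_ t); rewrite /= in_itv/= qp pf => /(_ isT)[//|Nt].
  by exfalso; apply: Mt; exists (pickle p).
move=> [n /= xq [Mt Bt]]; split => //; have [_ _ _ + _] := BN n.
by move=> /(_ t Bt)/=; rewrite !in_itv/= !andbT; exact: lt_trans.
Qed.

(** The identity from the Lebesgue to the Borel structure is measurable and pushes the completed
    measure to the Borel one. *)
Lemma integral_completed (D : set R) (f : R -> \bar R) : measurable (D : set BR) ->
  measurable_fun (D : set BR) (f : BR -> \bar R) -> (forall t, (0 <= f t)%E) ->
  (\int[mu]_(t in (D : set L)) f t = \int[lebesgue_measure]_(t in (D : set BR)) f t)%E.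
Proof.
move=> mD mf f0.
have mid : measurable_fun [set: L] (id : L -> BR).
  by move=> _ Y mY; rewrite setTI; exact: borel_lebesgue_measurable.
rewrite -[LHS](@ge0_integral_pushforward _ _ L BR R id mid mu D f mD mf (fun t _ => f0 t)).
by apply: eq_measure_integral => E mE _.
Qed.

(* The domain has to be Borel: [measurable_fun] is vacuous on other sets. *)
Lemma borel_lebesgue_measurable_fun {d} {U : measurableType d} (D : set R) (f : R -> U) :
  measurable (D : set BR) ->
  measurable_fun (D : set BR) (f : BR -> U) -> measurable_fun (D : set L) (f : L -> U).
Proof. by move=> mD mf _ Y mY; apply: borel_lebesgue_measurable; exact: mf. Qed.

(** The function is cut off outside [[0, b]] and changed on a null set, which gives a Borel
    integrable [g1] on the whole line with the same integrals over Borel subsets of [[0, b]]. *)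
Lemma lebesgue_integral_ball_le (g : R -> R) (b : R) :
  (forall t, 0 <= g t) -> measurable_fun (`[0, b]%classic : set L) (g : L -> R) ->
  (\int[mu]_(t in (`[0%R, b]%classic : set L)) (g t)%:E < +oo)%E ->
  {ae mu, forall t, 0 < t < b -> forall e, 0 < e -> \forall r \near 0^'+,
    ball t r `<=` `[0, b]%classic /\
    (\int[mu]_(s in (ball t r : set L)) (g s)%:E <= (r *+ 2 * (g t + e))%R%:E)%E}.
Proof.
move=> g0 mg intg; pose E : set R := `[0, b]%classic.
have mE : measurable (E : set L) by exact: lebesgue_itv_measurable.
have mEB : measurable (E : set BR) by exact: measurable_itv.
have mgT : measurable_fun [set: L] (g \_ E : L -> R).
  by apply/(measurable_restrictT _ mE).
have [M [mM M0 mgM]] := lebesgue_borel_measurable_fun mgT.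
pose g1 : R -> R := (g \_ E) \_ (~` M).
have mg1 : measurable_fun [set: BR] (g1 : BR -> R).
  by apply/(measurable_restrictT _ (measurableC mM)).
have g1_ge0 t : 0 <= g1 t.
  by rewrite /g1 patchE; case: ifP => // _; rewrite patchE; case: ifP.
have g1E t : E t -> ~ M t -> g1 t = g t.
  by move=> Et Mt; rewrite /g1 patchE mem_set// patchE mem_set.
have g1_out t : ~ E t -> g1 t = 0.
  by move=> Et; rewrite /g1 patchE; case: ifP => // _; rewrite patchE memNset.
have int_g1 (U : set R) : measurable (U : set BR) -> U `<=` E ->
    (\int[mu]_(s in (U : set L)) (g s)%:E = \int[lebesgue_measure]_(s in (U : set BR)) (g1 s)%:E)%E.
  move=> mU UE; have mUL := borel_lebesgue_measurable mU.
  have mg1U : measurable_fun (U : set BR) (g1 : BR -> R) by exact: measurable_funTS mg1.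
  rewrite -integral_completed//; last exact/measurable_EFinP.
  apply: (ge0_ae_eq_integral mUL).
  - by apply/measurable_EFinP; exact: measurable_funS mg.
  - by apply/measurable_EFinP; exact: borel_lebesgue_measurable_fun.
  - by move=> t _; rewrite lee_fin.
  - by move=> t _; rewrite lee_fin.
  exists M; split => //; first exact: borel_lebesgue_measurable.
  move=> t /= h; apply: contrapT => Mt; apply: h => Ut.
  by rewrite g1E//; exact: UE.
have loc1 : locally_integrable setT g1.
  apply: open_integrable_locally; first exact: openT.
  apply/integrableP; split; first exact/measurable_EFinP.
  rewrite (_ : (\int[_]_(_ in _) _ = \int[lebesgue_measure]_(x in (E : set BR)) (g1 x)%:E)%E).
    by rewrite -int_g1.
  rewrite [RHS]integral_mkcond; apply: eq_integral => t _.
  rewrite patchE /= ger0_norm//; case: ifPn => // /negP; rewrite inE => Et.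
  by rewrite g1_out.
have [N [mN N0 subN]] := lebesgue_differentiation loc1.
exists (N `|` M); split.
- by apply: measurableU; exact: borel_lebesgue_measurable.
- apply/eqP; rewrite -measure_le0; apply: le_trans (measureU2 _ _ _) _.
  + exact: borel_lebesgue_measurable.
  + exact: borel_lebesgue_measurable.
  by rewrite [X in (X + _)%E](N0 : _ = 0%E) [X in (_ + X)%E](M0 : _ = 0%E) adde0.
move=> t /= h; apply: contrapT => /not_orP[Nt Mt]; apply: h => /andP[t0 tb] e e0.
have Et : E t by rewrite /E /= in_itv/= !ltW.
have lt : lebesgue_pt g1 t by apply: contrapT => h; apply/Nt/subN.
have ballE : \forall r \near 0^'+, ball t r `<=` E.
  near=> r => s; rewrite -ball_normE /= ltr_norml /E /= in_itv/= => /andP[h1 h2].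
  have r1 : r <= t by near: r; exact: nbhs_right_le.
  have r2 : r <= b - t by near: r; apply: nbhs_right_le; rewrite subr_gt0.
  lra.
have davg_le : \forall r \near 0^'+, (davg g1 t r <= e%:E)%E.
  move/fine_cvgP : lt => [fin /cvgrPdist_le /(_ _ e0) h].
  apply: filterS2 fin h => r fr; rewrite sub0r normrN => hr.
  by rewrite -(fineK fr) lee_fin (le_trans (ler_norm _)).
near=> r.
have r0 : 0 < r by near: r; exact: nbhs_right_gt.
have bE : ball t r `<=` E by near: r.
split => //.
have mball : measurable (ball t r : set BR) by exact: measurable_ball.
rewrite int_g1//.
have : (davg g1 t r <= e%:E)%E by near: r.
have r2 : 0 < r *+ 2 by rewrite mulrn_wgt0.
rewrite /davg /iavg lebesgue_measure_ball; last exact: ltW.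
rewrite inver ifF ?lee_pdivrMl ?mulrn_wgt0//; last first.
  by rewrite gt_eqF// mulrn_wgt0.
move=> h.
have mg1b : measurable_fun (ball t r : set BR) (g1 : BR -> R) by exact: measurable_funTS mg1.
have mc : measurable_fun (ball t r : set BR) (fun s : BR => `|g1 s - g1 t|).
  by apply: measurableT_comp => //; exact: measurable_funB.
(* Here [g1 s] is at most its deviation from [g1 t] plus [g t]; over a ball of measure [r *+ 2] the
   deviation integrates to at most [r *+ 2 * e]. *)
apply: (@le_trans _ _ (\int[lebesgue_measure]_(y in (ball t r : set BR))
    (`|(center (g1 t) \o g1) y|%:E + (g t)%:E))%E).
  apply: ge0_le_integral => //=.
  - by move=> s _; rewrite lee_fin.
  - exact/measurable_EFinP.
  - by apply/measurable_EFinP; apply: measurable_funD.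
  - move=> s _; rewrite -EFinD lee_fin -(g1E t)//.
    by rewrite -lerBlDr ler_norm.
rewrite ge0_integralD//=; first last.
- by move=> s _; rewrite lee_fin.
- exact/measurable_EFinP.
rewrite integral_cst//= lebesgue_measure_ball; last exact: ltW.
rewrite [r *+ 2 * _]mulrDr [X in (_ <= X)%E]EFinD addeC leeD//.
  by rewrite mulrC EFinM.
Unshelve. all: by end_near. Qed.

End lebesgue_borel.

Section bochner_primitive.
Context {R : realType} {H : completeNormedModType R}.
Local Notation mu := (@completed_lebesgue_measure R).
Local Notation L := (lebesgueType R).

Let mu_complete : measure_is_complete mu := completed_lebesgue_measure_is_complete.

Lemma completed_lebesgue_itv_fin (i : interval R) (b : R) :
  [set` i] `<=` `[0, b]%classic -> (mu [set` i] < +oo)%E.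
Proof.
move=> ib; apply: (@le_lt_trans _ _ (mu `[0, b]%classic)).
  by rewrite le_measure ?inE//; exact: lebesgue_itv_measurable.
rewrite completed_lebesgue_measureE lebesgue_measure_itv/=.
by case: ifP => // _; rewrite ltry.
Qed.

(* Points [t] at which [y] is approximated by its value in the mean: the scalar
   differentiation theorem is applied to [`|y - h|] for the countably many
   values [h] of the simple functions that approximate [y]. *)
Lemma bochner_lebesgue_pt (y : R -> H) (b : R) :
  norm_integrable mu (`[0, b]%classic : set L) y ->
  {ae mu, forall t, 0 < t < b -> forall e, 0 < e -> \forall r \near 0^'+,
    ball t r `<=` `[0, b]%classic /\
    \int[mu]_(s in (ball t r : set L)) `|y s - y t| <= r * e}.
Proof.
move=> hy; have [my iy] := hy; have [s hs sy] := my.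
have mE : measurable (`[0, b]%classic : set L) by exact: lebesgue_itv_measurable.
have /choice[X rX] : forall n, exists X : seq H, range (s n) = [set` X].
  by move=> n; have [X ->] := (finite_seqP _).1 (hs n).1; exists X.
have hcst h : norm_integrable mu (`[0, b]%classic : set L) (fun=> h : H).
  by apply: norm_integrable_cst => //; exact: (@completed_lebesgue_itv_fin _ b).
have hyh h : norm_integrable mu (`[0, b]%classic : set L) (y \- fun=> h).
  exact: norm_integrableB.
have pt n i : {ae mu, forall t, 0 < t < b -> forall e, 0 < e -> \forall r \near 0^'+,
    ball t r `<=` `[0, b]%classic /\
    (\int[mu]_(s in (ball t r : set L)) (`|y s - nth 0 (X n) i|)%:E <=
      (r *+ 2 * (`|y t - nth 0 (X n) i| + e))%R%:E)%E}.
  have hni := hyh (nth 0 (X n) i).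
  apply: (lebesgue_integral_ball_le (g := fun t => `|y t - nth 0 (X n) i|)).
  - by move=> t; exact: normr_ge0.
  - exact: (strongly_measurable_norm mu_complete mE hni.1).
  have /integrableP[_ h] := hni.2; apply: le_lt_trans h.
  by rewrite le_eqVlt; apply/orP; left; apply/eqP/eq_integral => t _; rewrite abse_EFin normr_id.
have {}pt := ae_foralln (fun n => ae_foralln (pt n)).
move: sy pt; apply: filterS2 => t sy pt /andP[t0 tb] e e0.
have tE : `[0, b]%classic t by rewrite /= in_itv/= !ltW.
(* Three errors of size [e / 8] are integrated over length [r *+ 2], in total [3 / 4 * (r * e)]. *)
have e8 : 0 < e / 8 by rewrite divr_gt0.
have /cvgrPdist_le /(_ _ e8) [n _ /(_ n (leqnn n)) /= hn] := sy tE.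
have sX : s n t \in X n by have : range (s n) (s n t) by [exists t]; rewrite rX.
(* The null set was fixed for all listed values beforehand, so the value may now be chosen depending
   on [t]. *)
have := pt n (index (s n t) (X n)); rewrite t0 tb nth_index// => /(_ isT _ e8).
move=> near_r; near=> r.
have [bE ler] : ball t r `<=` `[0, b]%classic /\
    (\int[mu]_(s0 in (ball t r : set L)) (`|y s0 - s n t|)%:E <=
      (r *+ 2 * (`|y t - s n t| + e / 8))%R%:E)%E by near: r.
have r0 : 0 < r by near: r; exact: nbhs_right_gt.
split => //.
have ballE : ball t r = `]t - r, t + r[%classic by rewrite ball_itv.
have mb : measurable (ball t r : set L).
  by rewrite ballE; exact: lebesgue_itv_measurable.
have hb (z : R -> H) : norm_integrable mu (`[0, b]%classic : set L) z ->
    norm_integrable mu (ball t r : set L) z.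
  exact: norm_integrableS.
have i1 := hb _ (hyh (s n t)).
have i2 := hb _ (hcst (s n t - y t)).
have i3 := hb _ (hyh (y t)).
apply: (@le_trans _ _ (\int[mu]_(z in (ball t r : set L)) (`|y z - s n t| + `|s n t - y t|))).
  apply: le_Rintegral => //; first exact: i3.2.
    by have := integrableD mb i1.2 i2.2.
  by move=> z _; rewrite -{1}(subrK (s n t) (y z)) -addrA ler_normD.
rewrite RintegralD//; [|exact: i1.2|exact: i2.2].
have muball : mu (ball t r) = (r *+ 2)%:E by exact: (lebesgue_measure_ball t (ltW r0)).
rewrite Rintegral_cst// (_ : fine _ = r *+ 2); last exact: (congr1 fine muball).
have : \int[mu]_(z in (ball t r : set L)) `|y z - s n t| <= r *+ 2 * (`|y t - s n t| + e / 8).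
  rewrite -lee_fin /Rintegral fineK//.
  by apply: integrable_fin_num => //; exact: i1.2.
rewrite (distrC (s n t)) mulr2n; clear - hn r0 e0; nra.
Unshelve. all: by end_near. Qed.

End bochner_primitive.

Section bochner_primitive_derivative.
Context {R : realType} {H : completeNormedModType R} (ip : {dot H for idfun}).
Hypothesis ip_norm : forall u : H, ip u u = `|u| ^+ 2.
Local Notation mu := (@completed_lebesgue_measure R).
Local Notation L := (lebesgueType R).
Local Notation I y t := (bochner_integral mu (`[0, t]%classic : set L) y).

Let mu_complete : measure_is_complete mu := completed_lebesgue_measure_is_complete.

Let mitv (i : interval R) : measurable ([set` i] : set L).
Proof. exact: lebesgue_itv_measurable. Qed.

Let sub_itv (s t b : R) : 0 <= s -> t <= b -> `]s, t] `<=` (`[0, b] : set R).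
Proof.
move=> s0 tb u /=; rewrite !in_itv/= => /andP[su ut].
by rewrite (le_trans s0 (ltW su)) (le_trans ut tb).
Qed.

Lemma bochner_integrable_itv (y : L -> H) (b t : R) : t <= b ->
  bochner_integrable mu `[0, b] y -> bochner_integrable mu `[0, t] y.
Proof.
move=> tb; apply: bochner_integrableS => //.
  exact: (@completed_lebesgue_itv_fin _ _ b).
by apply: subset_itvl; rewrite bnd_simp.
Qed.

(** Additivity over adjacent intervals is inherited from the scalar integrals of [ip (y u) h]. *)
Lemma bochner_increment_weak (y : L -> H) (b s t : R) :
  bochner_integrable mu `[0, b] y -> 0 <= s -> s <= t -> t <= b ->
  weak_integral ip mu (`]s, t]%classic : set L) y (I y t - I y s).
Proof.
move=> iy s0 st tb h.
have fin c : c <= b -> (mu `[0%R, c]%classic < +oo)%E.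
  move=> cb; apply: (@completed_lebesgue_itv_fin _ _ b).
  by apply: subset_itvl; rewrite bnd_simp.
have itb c : c <= b -> bochner_integrable mu (`[0, c]%classic : set L) y.
  by move=> cb; exact: bochner_integrable_itv iy.
have ni : norm_integrable mu (`[0, t]%classic : set L) y.
  by apply: bochner_integrable_norm => //; [exact: fin|exact: itb].
rewrite ipDl ipNl.
rewrite (bochner_integralP ip_norm mu_complete _ _ (itb t _))//; last exact: fin.
rewrite (bochner_integralP ip_norm mu_complete _ _ (itb s _))//; last 2 first.
  by apply: fin; exact: le_trans tb.
  exact: le_trans tb.
have -> : `[0, t]%classic = `[0, s]%classic `|` `]s, t]%classic :> set L.
  by rewrite -itv_bndbnd_setU// bnd_simp.
rewrite Rintegral_setU//.
- by rewrite addrC addKr.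
- rewrite -itv_bndbnd_setU ?bnd_simp//; exact: (ip_integrable ip_norm mu_complete _ _ ni).
- apply/disj_setPS => u [] /=; rewrite !in_itv/= => /andP[_ us] /andP[su _].
  by have := lt_le_trans su us; rewrite ltxx.
Qed.

(** The vector [(t - s) *: v] is the weak integral of the constant [v], so the left side is the norm
    of a weak integral of [y - v]. *)
Lemma bochner_increment_norm (y : L -> H) (b s t : R) v :
  bochner_integrable mu `[0, b] y -> 0 <= s -> s <= t -> t <= b ->
  `|I y t - I y s - (t - s) *: v| <= \int[mu]_(u in (`]s, t]%classic : set L)) `|y u - v|.
Proof.
move=> iy s0 st tb.
have wi := bochner_increment_weak iy s0 st tb.
have niy : norm_integrable mu (`]s, t]%classic : set L) y.
  apply: (@norm_integrableS _ L R H mu _ _ y (mitv _) (mitv _) (sub_itv s0 tb)).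
  by apply: bochner_integrable_norm => //; exact: (@completed_lebesgue_itv_fin _ _ b).
have nic : norm_integrable mu (`]s, t]%classic : set L) (fun=> v).
  apply: norm_integrable_cst => //.
  exact: (@completed_lebesgue_itv_fin _ _ b) (sub_itv s0 tb).
have wv : weak_integral ip mu (`]s, t]%classic : set L) (fun=> v) ((t - s) *: v).
  move=> h; rewrite Rintegral_cst// ipZl mulrC; congr (_ * _).
  have st_len : lebesgue_measure (`]s, t]%classic : set R) = (t - s)%:E.
    rewrite lebesgue_measure_itv/= lte_fin; case: ltgtP st => // -> _.
    by rewrite subrr.
  exact: esym (congr1 fine st_len).
have niB := norm_integrableB mu_complete (mitv _) niy nic.
apply: (weak_integral_norm ip_norm mu_complete _ niB) => //.
exact: weak_integralB.
Qed.

Lemma is_derive_bochner_primitive (x : R -> H) (y : L -> H) (b : R) :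
  bochner_integrable mu `[0, b] y ->
  (forall t, 0 <= t <= b -> x t = x 0 + I y t) ->
  {ae mu, forall t, 0 < t < b ->
    is_derive (t : R^o) (1 : R^o) (x : R^o -> H) (y t)}.
Proof.
move=> iy xI.
have ni : norm_integrable mu (`[0, b]%classic : set L) y.
  by apply: bochner_integrable_norm => //; exact: (@completed_lebesgue_itv_fin _ _ b).
have [N [mN N0 subN]] := bochner_lebesgue_pt ni; exists N; split => //.
apply: subset_trans subN; apply: subsetC => t pt t0b; have [t0 tb] := andP t0b.
suff cv : h^-1 *: (((x : R^o -> H) \o shift (t : R^o)) (h *: (1 : R^o)) - x t) @[h --> 0^'] --> y t.
  apply: DeriveDef; first by apply/cvg_ex; exists (y t).
  by apply: cvg_lim => //; exact: norm_hausdorff.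
apply/cvgrPdist_le => e e0.
have [d /= d0 hd] := pt t0b _ (divr_gt0 e0 (ltr0n R 2)).
near=> h.
have h0 : h != 0 by near: h; exact: nbhs_dnbhs_neq.
have h0' : 0 < `|h| by rewrite normr_gt0.
have hd2 : `|h| < d / 2 by near: h; apply: dnbhs0_lt; rewrite divr_gt0.
(* The doubled radius puts [t + h] strictly inside the ball; it is paid for by the tolerance
   [e / 2]. *)
have [] := hd (2 * `|h|).
- by rewrite /= sub0r normrN normrM normr_id ger0_norm// mulrC -ltr_pdivlMr.
- by rewrite mulr_gt0.
move=> bE ile.
have mball : measurable (ball t (2 * `|h|) : set L) by rewrite ball_itv; exact: mitv.
have key s s' : 0 <= s -> s <= s' -> s' <= b -> `]s, s'] `<=` ball t (2 * `|h|) ->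
    `|x s' - x s - (s' - s) *: y t| <= `|h| * e.
  move=> s0 ss s'b sub.
  rewrite (xI s') ?(le_trans s0 ss)// (xI s) ?s0 ?(le_trans ss s'b)//.
  rewrite opprD addrACA subrr add0r.
  apply: le_trans (bochner_increment_norm _ iy s0 ss s'b) _.
  apply: le_trans (_ : 2 * `|h| * (e / 2) <= _); last first.
    by rewrite mulrC mulrA divfK// mulrC.
  apply: le_trans ile.
  have nib : norm_integrable mu (ball t (2 * `|h|) : set L) (y \- fun=> y t).
    apply: (@norm_integrableS _ L R H mu _ _ _ mball (mitv _) bE).
    apply: norm_integrableB => //; apply: norm_integrable_cst => //.
    exact: (@completed_lebesgue_itv_fin _ _ b).
  exact: (@Rintegral_norm_subset _ L R H mu _ _ _ (mitv _) mball sub nib).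
have th : ball t (2 * `|h|) (t + h).
  by rewrite -ball_normE /= opprD addNKr normrN ltr_pMl// ltr1n.
have := bE _ th; rewrite /= in_itv/= => /andP[th0 thb].
rewrite -(@ler_pM2l _ `|h|)//.
rewrite -[X in X * `|_| <= _]/(`|h|) -normrZ scalerBr scalerA divff// scale1r.
have h1 : h *: (1 : R^o) = h by exact: mulr1.
rewrite /= h1 (addrC h) distrC.
have [hp|hn] := ltP 0 h.
  have := key t (t + h) (ltW t0); rewrite (addrC t) addrK addrC; apply => //.
    by rewrite lerDl ltW.
  move=> u /=; rewrite in_itv/= -ball_normE /= => /andP[tu uth].
  rewrite ltr0_norm ?subr_lt0// gtr0_norm// opprB.
  by apply: le_lt_trans (_ : _ <= h) _; rewrite ?lerBlDl// ltr_pMl// ltr1n.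
have := key (t + h) t th0; rewrite opprD addNKr => {}key.
rewrite -normrN; have -> : - (x (t + h) - x t - h *: y t) = x t - x (t + h) - (- h) *: y t.
  by apply: (ip_ext ip_norm) => w; rewrite !ipE; ring.
apply: key; [by rewrite gerDl|exact: ltW|].
move=> u /=; rewrite in_itv/= -ball_normE /= => /andP[tu uth].
rewrite ger0_norm ?subr_ge0// ler0_norm//; apply: lt_le_trans (_ : _ < - h) _.
  by rewrite ltrBlDl ltrBrDr.
by rewrite ler_peMl ?oppr_ge0// ler1n.
Unshelve. all: by end_near. Qed.

End bochner_primitive_derivative.

(** * Bochner integrability from bounded simple approximations *)

Section bochner_dominated.
Context {d : measure_display} {T : measurableType d} {R : realType}
  {H : completeNormedModType R} (mu : {measure set T -> \bar R}).
Hypothesis mu_complete : measure_is_complete mu.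
Variables (D : set T) (mD : measurable D).
Hypothesis D_fin : (mu D < +oo)%E.

Lemma bochner_integrable_dominated (y : T -> H) (s : nat -> T -> H) (M : R) :
  (forall n, simple_map (s n)) ->
  (forall t, D t -> s n t @[n --> \oo] --> y t) ->
  (forall n t, D t -> `|s n t| <= M) -> bochner_integrable mu D y.
Proof.
move=> hs sy sM.
have yM t : D t -> `|y t| <= M.
  move=> Dt; have c1 : `|s n t| @[n --> \oo] --> `|y t| by apply: cvg_norm; exact: sy.
  by apply: ler_cvg_to c1 (cvg_cst M) _; apply: nearW => n; exact: sM.
have my : strongly_measurable mu D y.
  by exists s => //; apply: aeW => t Dt; exact: sy.
exists s; split.
- move=> n; have [fs ms] := hs n; split => // h _.
  rewrite (le_lt_trans _ D_fin)// le_measure ?inE//; exact: measurableI.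
- by apply: aeW => t Dt; exact: sy.
have mB n : measurable_fun D (fun t => (`|y t - s n t|)%:E).
  apply/measurable_EFinP/(strongly_measurable_norm mu_complete mD).
  by apply: strongly_measurableB my _; exact: simple_map_strongly_measurable.
have [||||_ _] := @dominated_convergence _ _ _ mu D mD
  (fun n t => (`|y t - s n t|)%:E) (cst 0%E) (cst (2 * M)%:E) mB.
- exact: measurable_cst.
- apply: aeW => t Dt; apply: cvg_EFin; first exact: nearW.
  rewrite /comp /= -(normr0 H) -(subrr (y t)); apply: cvg_norm; apply: cvgB (sy t Dt).
  exact: cvg_cst.
- by apply/integrableP; split => //; rewrite integral_cst//= lte_mul_pinfty.
- apply: aeW => t n Dt; rewrite /= normr_id lee_fin (le_trans (ler_normB _ _))//.
  by rewrite mulr_natl mulr2n lerD ?sM ?yM.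
by rewrite integral0_eq.
Qed.

(** Since [f] is controlled only on [D], the extra value [None] marks the complement and makes the
    code a simple map on all of [T]. *)
Lemma simple_map_truncn (f : T -> R) (m : R) :
  measurable_fun D f -> (forall t, D t -> 0 <= f t <= m) ->
  simple_map (fun t => if t \in D then Some (Num.truncn (f t)) else None).
Proof.
move=> mf fm; split.
  apply: (@sub_finite_set _ _ (None |` [set Some k | k in `I_(Num.truncn m).+1])).
    move=> _ [t _ <-]; case: ifPn => [/set_mem Dt|_]; [right|by left].
    have /andP[_ ftm] := fm t Dt.
    by exists (Num.truncn (f t)) => //=; rewrite ltnS le_truncn.
  by rewrite finite_setU; split; [exact: finite_set1|exact/finite_image/finite_II].
case=> [k|].
  rewrite (_ : _ @^-1` _ = D `&` f @^-1` `[k%:R, k.+1%:R[).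
    by apply: mf => //; exact: measurable_itv.
  apply/seteqP; split => t /=.
    case: ifPn => // /set_mem Dt [tk]; split => //; have /andP[ft _] := fm t Dt.
    by rewrite in_itv/= -truncn_eq// tk.
  move=> [Dt]; rewrite in_itv/= mem_set// -truncn_eq; first by move=> /eqP ->.
  by have /andP[] := fm t Dt.
rewrite (_ : _ @^-1` _ = ~` D); first exact: measurableC.
apply/seteqP; split => t /=; first by case: ifPn => // /negP + _ Dt; rewrite inE.
by move=> Dt; rewrite memNset.
Qed.

End bochner_dominated.

Section weak_integral_bounds.
Context {d : measure_display} {T : measurableType d} {R : realType}
  {H : completeNormedModType R} (ip : {dot H for idfun}).
Hypothesis ip_norm : forall u : H, ip u u = `|u| ^+ 2.
Variable mu : {measure set T -> \bar R}.
Hypothesis mu_complete : measure_is_complete mu.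
Variables (D : set T) (mD : measurable D).

Lemma weak_integral_norm_ae (y : T -> H) (v : H) (f : T -> R) (C : R) :
  norm_integrable mu D y -> weak_integral ip mu D y v ->
  measurable_fun D f -> (forall t, D t -> 0 <= f t) ->
  (\int[mu]_(t in D) (f t)%:E <= C%:E)%E ->
  {ae mu, forall t, D t -> `|y t| <= f t} -> `|v| <= C.
Proof.
move=> hy yv mf f0 intf yf.
apply: le_trans (weak_integral_norm ip_norm mu_complete mD hy yv) _.
rewrite -lee_fin /Rintegral fineK; last by apply: integrable_fin_num => //; exact: hy.2.
apply: le_trans intf; apply: ae_ge0_le_integral => //.
- by have /integrableP[] := hy.2.
- exact/measurable_EFinP.
Qed.

End weak_integral_bounds.

Section exponential_weight.
Context {R : realType}.
Local Notation mu := (@completed_lebesgue_measure R).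
Local Notation L := (lebesgueType R).

(** The primitive is [expR (c * u) / c]; dropping its value at 0 leaves a multiple of the weight
    itself, so that estimates can be iterated. *)
Lemma integral_expR_le (c t : R) : 0 < c -> 0 <= t ->
  (\int[mu]_(u in (`[0%R, t]%classic : set L)) (expR (c * u)%R)%:E <= (expR (c * t) / c)%R%:E)%E.
Proof.
move=> c0; have cexp : continuous (fun u : R => expR (c * u)).
  by move=> u; apply: continuous_comp; [exact: mulrl_continuous|exact: continuous_expR].
have mexp : measurable_fun (`[0, t]%classic : set (measurableTypeR R))
    (fun u : R => (expR (c * u))%:E).
  by apply/measurable_EFinP; apply: measurable_funTS; exact: continuous_measurable_fun.
have mI : measurable (`[0, t]%classic : set (measurableTypeR R)) by exact: measurable_itv.
rewrite (integral_completed mI mexp) => [|u]; last by rewrite lee_fin expR_ge0.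
rewrite le_eqVlt => /predU1P[<-|t0].
  by rewrite set_itv1 integral_set1 lee_fin divr_ge0 ?expR_ge0// ltW.
have dF (u : R) : is_derive (u : R^o) (1 : R^o)
    (fun u : R => expR (c * u) / c : R^o) (expR (c * u)).
  have d1 := @is_deriveZ R R^o R^o id c u 1 1 (is_derive_id _ _).
  have d2 := is_derive1_comp (is_derive_expR (c * u)) d1.
  have d3 := @is_deriveZ R R^o R^o _ c^-1 u 1 _ d2.
  rewrite (_ : (fun _ => _) = c^-1 \*: (expR \o (c \*: id))); last first.
    by apply/funext => w; rewrite /= mulrC.
  apply: is_derive_eq d3 _; rewrite [c *: 1]mulr1 [LHS]mulrC.
  exact: mulfK (lt0r_neq0 c0) _.
rewrite (@continuous_FTC2 _ _ (fun u => expR (c * u) / c))//.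
- by rewrite -EFinB lee_fin gerBl divr_ge0 ?expR_ge0// ltW.
- by apply: continuous_subspaceT.
- have cF : continuous (fun u : R => expR (c * u) / c).
    by move=> u; apply: cvgM; [exact: cexp|exact: cvg_cst].
  split; first by move=> u _.
    by apply: cvg_at_right_filter; exact: cF.
  by apply: cvg_at_left_filter; exact: cF.
- by move=> u _; rewrite derive1E; exact: derive_val.
Qed.

Lemma measurable_weight (C c t : R) :
  measurable_fun (`[0, t]%classic : set L) (fun u : L => C * expR (c * u)).
Proof.
apply: (@borel_lebesgue_measurable_fun _ _ _ _ (fun u : R => C * expR (c * u))).
  exact: measurable_itv.
apply: measurable_funTS; apply: continuous_measurable_fun => u.
apply: cvgM; first exact: cvg_cst.
by apply: continuous_comp; [exact: mulrl_continuous|exact: continuous_expR].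
Qed.

Lemma integral_weight_le (C c t : R) : 0 <= C -> 0 < c -> 0 <= t ->
  (\int[mu]_(u in (`[0%R, t]%classic : set L)) (C * expR (c * u))%R%:E
    <= (C / c * expR (c * t))%R%:E)%E.
Proof.
move=> C0 c0 t0; under eq_integral do rewrite EFinM.
have mw : measurable_fun (`[0, t]%classic : set L) (fun u : L => (expR (c * u))%:E).
  apply/measurable_EFinP.
  rewrite (_ : (fun _ => _) = fun u : L => 1 * expR (c * u)); first exact: measurable_weight.
  by apply/funext => u; rewrite mul1r.
have mI : measurable (`[0, t]%classic : set L) by exact: lebesgue_itv_measurable.
rewrite (ge0_integralZl _ mI mw) ?lee_fin//.
rewrite -mulrA (mulrC c^-1) EFinM lee_wpmul2l ?lee_fin//; exact: integral_expR_le.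
Qed.

End exponential_weight.

(** * Differential equations with measurable time dependence *)

Section caratheodory_field.
Context {R : realType} {H : completeNormedModType R}.
Local Notation mu := (@completed_lebesgue_measure R).
Local Notation L := (lebesgueType R).
Variables (F : R -> H -> H) (beta : R) (g : R -> R) (K : R).
Hypotheses (beta_gt0 : 0 < beta) (g_dom : forall t, 0 <= t -> 0 < g t < beta).
Hypothesis g_meas : measurable_fun (`[0, +oo[ : set L) (g : L -> R).
Hypothesis K_ge0 : 0 <= K.
Hypothesis F_lip : forall c, 0 < c < beta -> forall x y, `|F c x - F c y| <= K * `|x - y|.
Hypothesis F_bounded : forall x, exists M, forall c, 0 < c < beta -> `|F c x| <= M.
Hypothesis F_param : forall c x, 0 < c < beta -> exists C, forall c', 0 < c' < beta ->
  `|F c' x - F c x| <= C * `|c' - c|.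

Let code (b : R) n (f : R -> R) (t : L) : option nat :=
  if t \in (`[0, b]%classic : set R) then Some (Num.truncn (n.+1%:R * f t)) else None.

(* [k.+1 / n.+2] instead of [k / n.+1] keeps the value in [`]0, beta[]. *)
Let discretized_gamma n k := beta * (k.+1%:R / n.+2%:R).
Let discretized_time n j : R := j%:R / n.+1%:R.

(** Rounding down keeps [t'] in [[0, t]], where the Lipschitz bound on the trajectory is
    available. *)
Let discretized_time_bounds n t : 0 <= t ->
  let t' := discretized_time n (Num.truncn (n.+1%:R * t)) in
  0 <= t' <= t /\ t - t' <= n.+1%:R^-1.
Proof.
move=> t0 /=; rewrite /discretized_time.
have n0 : 0 < n.+1%:R :> R by rewrite ltr0n.
have := truncn_itv (mulr_ge0 (ltW n0) t0); move: (Num.truncn _) => j /andP[h1 h2].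
split.
  rewrite divr_ge0 ?ler0n//= ler_pdivrMr// mulrC//.
have : t < j.+1%:R / n.+1%:R by rewrite ltr_pdivlMr// mulrC.
by rewrite -natr1 mulrDl mul1r lerBlDl => /ltW.
Qed.

Let discretized_gamma_bounds n c : 0 < c < beta ->
  let c' := discretized_gamma n (Num.truncn (n.+1%:R * (c / beta))) in
  0 < c' < beta /\ `|c' - c| <= beta * n.+1%:R^-1.
Proof.
move=> /andP[c0 cb] /=; rewrite /discretized_gamma.
have th0 : 0 < c / beta by rewrite divr_gt0.
have th1 : c / beta < 1 by rewrite ltr_pdivrMr// mul1r.
have cE : c = beta * (c / beta) by rewrite mulrC divfK// gt_eqF.
rewrite [X in `|_ - X|]cE; move: (c / beta) th0 th1 {cE} => th th0 th1.
have n0 : 0 < n.+1%:R :> R by rewrite ltr0n.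
have := truncn_itv (mulr_ge0 (ltW n0) (ltW th0)); move: (Num.truncn _) => k.
have -> : n.+2%:R = n.+1%:R + 1 :> R by rewrite natr1.
have -> : k.+1%:R = k%:R + 1 :> R by rewrite natr1.
move=> /andP[]; have : 0 <= k%:R :> R by rewrite ler0n.
move: (k%:R) (n.+1%:R) n0 => {}k {}n n0 k0 h1 h2.
have n1 : 0 < n + 1 by lra.
(* [n] now stands for the former [n.+1]. As [c / beta < 1], the truncation is below it, so [q < 1]
   and the rounded parameter stays admissible. *)
have kn : k < n by nra.
pose q := (k + 1) / (n + 1).
have qE : q * (n + 1) = k + 1 by rewrite /q divfK// gt_eqF.
have q0 : 0 < q by rewrite divr_gt0//; lra.
have q1 : q < 1 by rewrite ltr_pdivrMr//; lra.
rewrite -/q -mulrBr normrM gtr0_norm// mulr_gt0//= gtr_pMr// q1; split => //.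
rewrite ler_pM2l// -[n^-1]mul1r ler_pdivlMr// -{1}(gtr0_norm n0) -normrM ler_norml; nra.
Qed.

(** The approximants evaluate the field at the rounded parameter and the rounded time. They depend
    on two integer codes only, hence are simple, and they converge because the field is continuous
    in each variable. *)
Lemma caratheodory_field_bochner_integrable (x : R -> H) (b N : R) :
  0 <= b -> 0 <= N ->
  (forall s t, 0 <= s -> s <= t -> t <= b -> `|x t - x s| <= N * (t - s)) ->
  bochner_integrable mu (`[0, b]%classic : set L) (fun t => F (g t) (x t)).
Proof.
move=> b0 N0 xN; pose D : set L := `[0, b]%classic.
have mD : measurable D by exact: lebesgue_itv_measurable.
have Dt0 t : D t -> 0 <= t by rewrite /D /= in_itv/= => /andP[].
have Dtb t : D t -> t <= b by rewrite /D /= in_itv/= => /andP[].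
pose Phi n (p : option nat * option nat) :=
  if p is (Some k, Some j) then F (discretized_gamma n k) (x (discretized_time n j)) else 0.
pose s n t := Phi n (code b n (fun t => g t / beta) t, code b n id t).
have sE n t : D t -> s n t = F (discretized_gamma n (Num.truncn (n.+1%:R * (g t / beta))))
    (x (discretized_time n (Num.truncn (n.+1%:R * t)))).
  by move=> Dt; rewrite /s /code mem_set.
have ms n : simple_map (s n).
  apply: (simple_map_comp (Phi n)); apply: simple_map_pair.
    apply: (@simple_map_truncn _ L R D mD (fun t => n.+1%:R * (g t / beta)) n.+1%:R).
      apply: measurable_funM; first exact: measurable_cst.
      apply: measurable_funM; last exact: measurable_cst.
      apply: (measurable_funS _ _ g_meas).
        exact: lebesgue_itv_measurable.
      by move=> t /Dt0 t0; rewrite /= in_itv/= andbT.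
    move=> t /Dt0/g_dom/andP[g0 gb].
    apply/andP; split; first by rewrite mulr_ge0 ?ler0n ?divr_ge0 ?ltW.
    by rewrite ler_piMr ?ler0n// ler_pdivrMr// mul1r ltW.
  apply: (@simple_map_truncn _ L R D mD (fun t => n.+1%:R * t) (n.+1%:R * b)).
    apply: (@borel_lebesgue_measurable_fun _ _ _ D (fun t : R => n.+1%:R * t)).
      exact: measurable_itv.
    by apply: measurable_funTS; apply: continuous_measurable_fun; exact: mulrl_continuous.
  by move=> t Dt; rewrite mulr_ge0 ?ler0n ?Dt0//= ler_wpM2l ?ler0n ?Dtb.
(* On [[0, b]] the trajectory stays within [N * b] of [x 0], which yields the common bound
   [M + K * (N * b)]. *)
have [M hM] := F_bounded (x 0).
apply: (@bochner_integrable_dominated _ L R H mu completed_lebesgue_measure_is_complete D mD _ _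
   s (M + K * (N * b)) ms).
- exact: (@completed_lebesgue_itv_fin _ _ b).
- move=> t Dt; have gt := g_dom (Dt0 t Dt).
  have [C' hC'] := F_param (x t) gt; pose C := `|C'|.
  have hC c : 0 < c < beta -> `|F c (x t) - F (g t) (x t)| <= C * `|c - g t|.
    by move=> /hC' /le_trans; apply; rewrite ler_wpM2r// ler_norm.
  (* [K * N] accounts for rounding the time, [C * beta] for rounding the parameter. *)
  have cv0 : (K * N + C * beta) * n.+1%:R^-1 @[n --> \oo] --> 0.
    rewrite -[X in _ --> X](mulr0 (K * N + C * beta)).
    by apply: cvgM; [exact: cvg_cst|exact: cvg_harmonic].
  apply/cvgrPdist_le => e e0; move/cvgrPdist_le : cv0 => /(_ _ e0).
  apply: filterS => n; rewrite sub0r normrN => /(le_trans (ler_norm _)); apply: le_trans.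
  rewrite distrC sE//.
  have [/andP[t'0 t't] tt'] := discretized_time_bounds n (Dt0 t Dt).
  have [c'b cc'] := discretized_gamma_bounds n gt.
  set t' := discretized_time _ _ in t'0 t't tt' *; set c' := discretized_gamma _ _ in c'b cc' *.
  have -> : F c' (x t') - F (g t) (x t) = (F c' (x t') - F c' (x t)) + (F c' (x t) - F (g t) (x t)).
    by rewrite addrA subrK.
  rewrite (le_trans (ler_normD _ _))// mulrDl lerD//.
    rewrite (le_trans (F_lip c'b _ _))// -mulrA ler_wpM2l// distrC.
    by rewrite (le_trans (xN _ _ t'0 t't (Dtb t Dt)))// ler_wpM2l.
  by rewrite (le_trans (hC _ c'b))// -mulrA ler_wpM2l// /C normr_ge0.
- move=> n t Dt; rewrite sE//; have gt := g_dom (Dt0 t Dt).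
  have [/andP[t'0 t't] tt'] := discretized_time_bounds n (Dt0 t Dt).
  have [c'b cc'] := discretized_gamma_bounds n gt.
  set t' := discretized_time _ _ in t'0 t't tt' *; set c' := discretized_gamma _ _ in c'b cc' *.
  have t'b : t' <= b by rewrite (le_trans t't)// Dtb.
  rewrite -(subrK (F c' (x 0)) (F c' (x t'))) addrC (le_trans (ler_normD _ _))//.
  rewrite lerD ?hM// (le_trans (F_lip c'b _ _))// ler_wpM2l//.
  rewrite (le_trans (xN _ _ (lexx 0) t'0 t'b))// subr0 ler_wpM2l//.
Qed.

End caratheodory_field.

Section weighted_estimates.
Context {R : realType} {H : completeNormedModType R} (ip : {dot H for idfun}).
Hypothesis ip_norm : forall u : H, ip u u = `|u| ^+ 2.
Local Notation mu := (@completed_lebesgue_measure R).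
Local Notation L := (lebesgueType R).
Local Notation I y t := (bochner_integral mu (`[0, t]%classic : set L) y).
Implicit Types y z : L -> H.

Let mu_complete : measure_is_complete mu := completed_lebesgue_measure_is_complete.

Lemma measurable_itv0 (t : R) : measurable (`[0, t]%classic : set L).
Proof. exact: lebesgue_itv_measurable. Qed.

Lemma measure_itv0_fin (t : R) : (mu (`[0%R, t]%classic : set L) < +oo)%E.
Proof. exact: (@completed_lebesgue_itv_fin _ _ t). Qed.

Lemma bochner_integral_weak y t : bochner_integrable mu (`[0, t]%classic : set L) y ->
  norm_integrable mu (`[0, t]%classic : set L) y /\
  weak_integral ip mu (`[0, t]%classic : set L) y (I y t).
Proof.
move=> iy; split.
  exact: (bochner_integrable_norm mu_complete (measurable_itv0 t) (measure_itv0_fin t)).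
exact: (bochner_integralP ip_norm mu_complete (measurable_itv0 t) (measure_itv0_fin t)).
Qed.

Section weight.
Variables (K : R) (K_gt0 : 0 < K).
Local Notation w t := (expR (2 * K * t)).

Lemma weak_integral_weight_le y v (C t : R) : 0 <= t -> 0 <= C ->
  norm_integrable mu (`[0, t]%classic : set L) y ->
  weak_integral ip mu (`[0, t]%classic : set L) y v ->
  {ae mu, forall u, 0 <= u <= t -> `|y u| <= C * w u} ->
  `|v| <= C / (2 * K) * w t.
Proof.
move=> t0 C0 ny wy yC.
apply: (weak_integral_norm_ae ip_norm mu_complete (measurable_itv0 t) ny wy
  (f := fun u => C * w u)).
- exact: measurable_weight.
- by move=> u _; rewrite mulr_ge0 ?expR_ge0.
- by apply: integral_weight_le => //; rewrite mulr_gt0.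
- by move: yC; apply: ae_imply => u yu; rewrite /= in_itv/=.
Qed.

Lemma bochner_integral_weight_le y (C t : R) : 0 <= t -> 0 <= C ->
  bochner_integrable mu (`[0, t]%classic : set L) y ->
  (forall u, 0 <= u <= t -> `|y u| <= C * w u) ->
  `|I y t| <= C / (2 * K) * w t.
Proof.
move=> t0 C0 /bochner_integral_weak[ny wy] yC.
by apply: weak_integral_weight_le ny wy _ => //; apply: aeW.
Qed.

Lemma bochner_integralB_weight_le y z (C t : R) : 0 <= t -> 0 <= C ->
  bochner_integrable mu (`[0, t]%classic : set L) y ->
  bochner_integrable mu (`[0, t]%classic : set L) z ->
  {ae mu, forall u, 0 <= u <= t -> `|y u - z u| <= C * w u} ->
  `|I y t - I z t| <= C / (2 * K) * w t.
Proof.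
move=> t0 C0 /bochner_integral_weak[ny wy] /bochner_integral_weak[nz wz].
apply: weak_integral_weight_le => //.
- exact: (norm_integrableB mu_complete (measurable_itv0 t) ny nz).
- exact: (weak_integralB ip_norm mu_complete (measurable_itv0 t) ny nz wy wz).
Qed.

(* A Gronwall argument: the estimate [`|x - z| <= N 2^-n w] improves by a factor
   2 under integration, since [\int_0^t w <= w t / (2 K)]. *)
Lemma bochner_gronwall (x z : R -> H) y y' (b : R) :
  bochner_integrable mu (`[0, b]%classic : set L) y ->
  bochner_integrable mu (`[0, b]%classic : set L) y' ->
  (forall t, 0 <= t <= b -> x t - z t = I y t - I y' t) ->
  {ae mu, forall u, 0 <= u <= b -> `|y u - y' u| <= K * `|x u - z u|} ->
  forall t, 0 <= t <= b -> x t = z t.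
Proof.
move=> iy iy' xz yy'.
have int_t t : t <= b -> bochner_integrable mu (`[0, t]%classic : set L) y /\
    bochner_integrable mu (`[0, t]%classic : set L) y'.
  by move=> tb; split; exact: bochner_integrable_itv tb _.
have nB t : t <= b -> norm_integrable mu (`[0, t]%classic : set L) (y \- y').
  move=> /int_t[/bochner_integral_weak[ny _] /bochner_integral_weak[ny' _]].
  exact: (norm_integrableB mu_complete (measurable_itv0 t) ny ny').
pose N := \int[mu]_(u in (`[0, b]%classic : set L)) `|y u - y' u|.
(* [N] starts the induction: it bounds the difference on all of [[0, b]] using only integrability of
   the two densities. *)
have N0 : 0 <= N by exact: Rintegral_ge0.
have le n t : 0 <= t <= b -> `|x t - z t| <= N * 2^-1 ^+ n * w t.
  elim: n t => [|n IH] t /andP[t0 tb].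
    rewrite expr0 mulr1 xz ?t0//.
    have [/bochner_integral_weak[ny wy] /bochner_integral_weak[ny' wy']] := int_t t tb.
    have := weak_integral_norm ip_norm mu_complete (measurable_itv0 t) (nB t tb)
      (weak_integralB ip_norm mu_complete (measurable_itv0 t) ny ny' wy wy').
    move=> /le_trans; apply; apply: le_trans (_ : N <= _); last first.
      rewrite ler_peMr// -expR0 ler_expR !mulr_ge0// ltW//.
    apply: (Rintegral_norm_subset (measurable_itv0 t) (measurable_itv0 b) _ (nB b (lexx b))).
    by apply: subset_itvl; rewrite bnd_simp.
  rewrite xz ?t0//; have [iyt iyt'] := int_t t tb.
  have C0 : 0 <= K * (N * 2^-1 ^+ n) by rewrite !mulr_ge0 ?exprn_ge0 ?invr_ge0// ltW.
  apply: le_trans (bochner_integralB_weight_le t0 C0 iyt iyt' _) _.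
    move: yy'; apply: ae_imply => u yu /andP[u0 ut].
    have ub : 0 <= u <= b by rewrite u0 (le_trans ut).
    by rewrite (le_trans (yu ub))// -mulrA ler_wpM2l ?IH// ltW.
  rewrite ler_wpM2r ?expR_ge0// exprSr mulrA le_eqVlt; apply/orP; left; apply/eqP.
  move: (2^-1 ^+ n) => q; field; exact: lt0r_neq0.
move=> t tb; apply/eqP; rewrite -subr_eq0 -normr_le0.
have cv : N * 2^-1 ^+ n * w t @[n --> \oo] --> 0.
  rewrite -[X in _ --> X](mul0r (w t)); apply: cvgM; last exact: cvg_cst.
  rewrite -[X in _ --> X](mulr0 N); apply: cvgM; first exact: cvg_cst.
  by apply: cvg_expr; rewrite ger0_norm ?invr_ge0// invf_lt1// ltr1n.
by apply: ler_cvg_to (cvg_cst _) cv _; apply: nearW => n; exact: le.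
Qed.

End weight.

Lemma bochner_increment_le y (b s t N : R) :
  bochner_integrable mu (`[0, b]%classic : set L) y ->
  (forall u, 0 <= u <= b -> `|y u| <= N) ->
  0 <= s -> s <= t -> t <= b -> `|I y t - I y s| <= N * (t - s).
Proof.
move=> iy yN s0 st tb.
have N0 : 0 <= N by rewrite (le_trans _ (yN s _))// s0 (le_trans st tb).
have sub : `]s, t] `<=` (`[0, b]%classic : set L).
  move=> u /=; rewrite !in_itv/= => /andP[su ut].
  by rewrite (le_trans s0 (ltW su)) (le_trans ut tb).
have mst : measurable (`]s, t]%classic : set L) by exact: lebesgue_itv_measurable.
have ny : norm_integrable mu (`]s, t]%classic : set L) y.
  apply: (@norm_integrableS _ L R H mu _ _ y mst (measurable_itv0 b) sub).
  exact: (bochner_integral_weak iy).1.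
apply: (weak_integral_norm_ae ip_norm mu_complete mst ny
  (bochner_increment_weak ip_norm iy s0 st tb) (f := fun=> N)) => //.
  have st_len : lebesgue_measure (`]s, t]%classic : set R) = (t - s)%:E.
    rewrite lebesgue_measure_itv/= lte_fin; case: ltgtP st => // -> _.
    by rewrite subrr.
  by rewrite integral_cst// EFinM; rewrite le_eqVlt; apply/orP; left; apply/eqP; congr (_ * _)%E.
by apply: aeW => u /sub; rewrite /= in_itv/=; exact: yN.
Qed.

End weighted_estimates.

(** * Picard iteration, existence and uniqueness *)

Section caratheodory_ode.
Context {R : realType} {H : completeNormedModType R} (ip : {dot H for idfun}).
Hypothesis ip_norm : forall u : H, ip u u = `|u| ^+ 2.
Local Notation mu := (@completed_lebesgue_measure R).
Local Notation L := (lebesgueType R).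
Local Notation I y t := (bochner_integral mu (`[0, t]%classic : set L) y).
Variables (F : R -> H -> H) (beta : R) (g : R -> R) (K : R) (x0 : H).
Hypotheses (beta_gt0 : 0 < beta) (g_dom : forall t, 0 <= t -> 0 < g t < beta).
Hypothesis g_meas : measurable_fun (`[0, +oo[ : set L) (g : L -> R).
Hypothesis K_gt0 : 0 < K.
Hypothesis F_lip : forall c, 0 < c < beta -> forall x y, `|F c x - F c y| <= K * `|x - y|.
Hypothesis F_bounded : forall x, exists M, forall c, 0 < c < beta -> `|F c x| <= M.
Hypothesis F_param : forall c x, 0 < c < beta -> exists C, forall c', 0 < c' < beta ->
  `|F c' x - F c x| <= C * `|c' - c|.

Local Notation w t := (expR (2 * K * t)).
Local Notation Fx x := ((fun t => F (g t) (x t)) : L -> H).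

Let w_ge1 t : 0 <= t -> 1 <= w t.
Proof. by move=> t0; rewrite -expR0 ler_expR !mulr_ge0// ltW. Qed.

Let w_le s t : s <= t -> w s <= w t.
Proof. by move=> st; rewrite ler_expR ler_wpM2l// mulr_ge0// ltW. Qed.

(* Bounds shared by all Picard iterates, hence by their limit. *)
Let picard_class M (x : R -> H) :=
  (forall t, 0 <= t -> `|x t - x0| <= M / K * w t) /\
  (forall b s t, 0 <= s -> s <= t -> t <= b -> `|x t - x s| <= 2 * M * w b * (t - s)).

Let picard (x : R -> H) t := x0 + I (Fx x) t.

Section bounded.
Variable M : R.
Hypothesis F_M : forall c, 0 < c < beta -> `|F c x0| <= M.

Let M_ge0 : 0 <= M.
Proof.
by apply: le_trans (F_M (c := beta / 2) _); rewrite ?divr_gt0//= ltr_pdivrMr// ltr_pMr// ltr1n.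
Qed.

Let Fx_integrable x t : picard_class M x -> 0 <= t ->
  bochner_integrable mu (`[0, t]%classic : set L) (Fx x).
Proof.
move=> [_ xlip] t0.
apply: (caratheodory_field_bochner_integrable beta_gt0 g_dom g_meas (ltW K_gt0)
  F_lip F_bounded F_param t0 _ (xlip t)).
by rewrite !mulr_ge0 ?expR_ge0.
Qed.

Let Fx_le x u : picard_class M x -> 0 <= u -> `|F (g u) (x u)| <= 2 * M * w u.
Proof.
move=> [xM _] u0; rewrite -(subrK (F (g u) x0) (F (g u) (x u))).
have h1 := F_lip (g_dom u0) (x u) x0; have h2 := F_M (g_dom u0).
have h3 : K * `|x u - x0| <= M * w u.
  apply: le_trans (ler_wpM2l (ltW K_gt0) (xM u u0)) _.
  by rewrite mulrA mulrCA divff ?gt_eqF// mulr1.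
have h4 : M <= M * w u by rewrite ler_peMr ?w_ge1.
have := ler_normD (F (g u) (x u) - F (g u) x0) (F (g u) x0); lra.
Qed.

Let picard_class_cst : picard_class M (fun=> x0).
Proof.
split => [t t0|b s t s0 st tb]; rewrite subrr normr0.
  by rewrite mulr_ge0 ?expR_ge0// divr_ge0// ltW.
by rewrite !mulr_ge0 ?expR_ge0// subr_ge0.
Qed.

(** If the distance to [x0] is at most [a * w t], the field is at most [(K * a + M) * w t] and its
    integral at most [(K * a + M) / (2 * K) * w t]. The choice [a = M / K] reproduces itself, and
    the field bound [2 * M * w t] becomes the Lipschitz bound. *)
Let picard_classP x : picard_class M x -> picard_class M (picard x).
Proof.
move=> hx; split => [t t0|b s t s0 st tb].
  rewrite /picard addrC addKr.
  have -> : M / K * w t = 2 * M / (2 * K) * w t.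
    by congr (_ * _); field; exact: lt0r_neq0.
  apply: (bochner_integral_weight_le ip_norm K_gt0 t0); first by rewrite mulr_ge0.
    exact: Fx_integrable.
  by move=> u /andP[u0 _]; exact: Fx_le.
rewrite /picard opprD addrACA subrr add0r.
have b0 : 0 <= b by rewrite (le_trans s0)// (le_trans st).
apply: (bochner_increment_le ip_norm (Fx_integrable hx b0)) => // u /andP[u0 ub].
apply: le_trans (Fx_le hx u0) _; rewrite ler_wpM2l ?w_le//; exact: mulr_ge0.
Qed.

Let picard_contraction x z C : picard_class M x -> picard_class M z -> 0 <= C ->
  (forall t, 0 <= t -> `|x t - z t| <= C * w t) ->
  forall t, 0 <= t -> `|picard x t - picard z t| <= C / 2 * w t.
Proof.
move=> hx hz C0 xz t t0; rewrite /picard opprD addrACA subrr add0r.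
have -> : C / 2 * w t = K * C / (2 * K) * w t.
  by congr (_ * _); field; exact: lt0r_neq0.
apply: (bochner_integralB_weight_le ip_norm K_gt0 t0).
- by rewrite mulr_ge0// ltW.
- exact: Fx_integrable.
- exact: Fx_integrable.
apply: aeW => u /andP[u0 ut]; apply: le_trans (F_lip (g_dom u0) _ _) _.
by rewrite -mulrA ler_wpM2l ?xz// ltW.
Qed.

Lemma caratheodory_fixed_point : exists2 x : R -> H,
  (forall b, 0 <= b -> bochner_integrable mu (`[0, b]%classic : set L) (Fx x)) &
  (forall t, 0 <= t -> x t = x0 + I (Fx x) t).
Proof.
pose xs n := iter n picard (fun=> x0).
have hxs n : picard_class M (xs n).
  by elim: n => [|n IH] //=; exact: picard_classP.
have A0 : 0 <= M / K by rewrite divr_ge0// ltW.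
have step n t : 0 <= t -> `|xs n.+1 t - xs n t| <= M / K * 2^-1 ^+ n * w t.
  elim: n t => [|n IH] t t0; first by rewrite expr0 mulr1; exact: (hxs 1).1.
  rewrite exprSr mulrA; apply: (picard_contraction (hxs n.+1) (hxs n)) => //.
  by rewrite mulr_ge0// exprn_ge0// invr_ge0.
(* The tail of the geometric series of the steps: [E n t - E n.+1 t] is exactly the bound in [step],
   so the distances telescope. *)
pose E n t : R := 2 * (M / K) * 2^-1 ^+ n * w t.
have E_ge0 n t : 0 <= E n t.
  by rewrite /E !mulr_ge0 ?expR_ge0 ?exprn_ge0 ?invr_ge0// ltW.
have tele n k t : 0 <= t -> `|xs (n + k)%N t - xs n t| <= E n t - E (n + k)%N t.
  move=> t0; elim: k => [|k IH]; first by rewrite addn0 !subrr normr0.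
  have := step (n + k)%N t t0; rewrite addnS.
  have := ler_normD (xs (n + k).+1 t - xs (n + k)%N t) (xs (n + k)%N t - xs n t).
  rewrite addrA subrK; move: IH; rewrite /E exprS.
  move: (2^-1 ^+ (n + k)) (M / K) => q a; lra.
have dist n m t : 0 <= t -> `|xs n t - xs m t| <= E n t + E m t.
  move=> t0; wlog nm : n m / (n <= m)%N.
    move=> W; have [/W//|/ltnW/W h] := leqP n m.
    by rewrite distrC [E n t + _]addrC.
  rewrite distrC -(subnKC nm); have := tele n (m - n)%N t t0.
  have := E_ge0 (n + (m - n))%N t; lra.
have E_cvg t : E n t @[n --> \oo] --> 0.
  rewrite /E -[X in _ --> X](mul0r (w t)); apply: cvgM; last exact: cvg_cst.
  rewrite -[X in _ --> X](mulr0 (2 * (M / K))); apply: cvgM; first exact: cvg_cst.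
  by apply: cvg_expr; rewrite ger0_norm ?invr_ge0// invf_lt1// ltr1n.
have cv t : 0 <= t -> cvg (xs n t @[n --> \oo]).
  by move=> t0; apply: (cvg_of_dist_le (E_cvg t)) => n m; exact: dist.
pose x t := lim (xs n t @[n --> \oo]).
have xs_x t : 0 <= t -> xs n t @[n --> \oo] --> x t by move=> /cv.
have lim_le t (v : H) (C : R) : 0 <= t ->
    (\forall n \near \oo, `|xs n t - v| <= C) -> `|x t - v| <= C.
  move=> t0 h; have c1 : `|xs n t - v| @[n --> \oo] --> `|x t - v|.
    by apply: cvg_norm; apply: cvgB; [exact: xs_x|exact: cvg_cst].
  exact: ler_cvg_to c1 (cvg_cst C) h.
(* The bounds are closed under pointwise limits; with them the field along [x] is integrable and
   [picard x] can be compared with the iterates. *)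
have hx : picard_class M x.
  split => [t t0|b s t s0 st tb].
    by apply: lim_le => //; apply: nearW => n; exact: (hxs n).1.
  have c1 : `|xs n t - xs n s| @[n --> \oo] --> `|x t - x s|.
    by apply: cvg_norm; apply: cvgB; apply: xs_x => //; exact: le_trans st.
  by apply: ler_cvg_to c1 (cvg_cst _) _; apply: nearW => n; exact: (hxs n).2.
have x_dist n t : 0 <= t -> `|x t - xs n t| <= E n t.
  move=> t0; apply: lim_le => //; exists n => // m /= nm.
  rewrite -(subnKC nm); have := tele n (m - n)%N t t0.
  have := E_ge0 (n + (m - n))%N t; lra.
exists x; first by move=> b b0; exact: Fx_integrable.
move=> t t0; apply/eqP; rewrite -subr_eq0 -normr_le0.
(* The distance from [x] to [picard x] is split at [xs n.+1], which is [picard (xs n)]; each part is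
   at most [E n t]. *)
apply: ler_cvg_to (cvg_cst _) (_ : (E n t + E n t) @[n --> \oo] --> 0) _.
  by rewrite -[X in _ --> X](addr0 0); exact: cvgD.
apply: nearW => n.
have x1 := x_dist n.+1 t t0.
have C0 : 0 <= 2 * (M / K) * 2^-1 ^+ n.
  by rewrite !mulr_ge0 ?exprn_ge0 ?invr_ge0// ltW.
have x2 := picard_contraction hx (hxs n) C0 (x_dist n) t0.
have En : E n.+1 t <= E n t.
  rewrite /E exprS; rewrite ler_wpM2r ?expR_ge0//.
  move: C0; move: (2^-1 ^+ n) (M / K) => q a; lra.
have En2 : 2 * (M / K) * 2^-1 ^+ n / 2 * w t <= E n t.
  rewrite /E ler_wpM2r ?expR_ge0//; lra.
rewrite -(subrK (xs n.+1 t) (x t)) -addrA.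
rewrite (le_trans (ler_normD _ _))// lerD//; first exact: le_trans x1 En.
by rewrite distrC; exact: le_trans x2 En2.
Qed.

End bounded.

Let ae_neq (a : R) : {ae mu, forall t, t != a}.
Proof.
exists [set a]; split.
- by apply: borel_lebesgue_measurable; exact: measurable_set1.
- exact: lebesgue_measure_set1.
- by move=> t /= /negP; rewrite negbK => /eqP.
Qed.

(** The interval is a single point, a null set; this recovers the initial value from the integral
    equation. *)
Let bochner_integral_point (y : L -> H) :
  bochner_integrable mu (`[0, 0]%classic : set L) y -> I y 0 = 0.
Proof.
move=> /(bochner_integral_weak ip_norm)[ny wy]; apply/eqP; rewrite -normr_le0.
apply: (weak_integral_norm_ae ip_norm completed_lebesgue_measure_is_complete
  (measurable_itv0 0) ny wy (f := fun=> `|y 0|)) => //.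
  rewrite integral_cst//; last exact: measurable_itv0.
  have m0 : lebesgue_measure (`[0, 0]%classic : set R) = 0%E.
    by rewrite set_itv1 lebesgue_measure_set1.
  by rewrite [X in (_ * X)%E](m0 : _ = 0%E) mule0.
by apply: aeW => u; rewrite set_itv1 /= => ->.
Qed.

Let is_solution_primitive (x : R -> H) : x 0 = x0 ->
  (forall b, 0 <= b -> bochner_integrable mu (`[0, b]%classic : set L) (Fx x)) ->
  (forall t, 0 <= t -> x t = x 0 + I (Fx x) t) -> strong_solution F g x0 x.
Proof.
move=> x_0 ix xE; split => //.
  move=> b b0; exists (Fx x); first exact/ix/ltW.
  by move=> t /andP[t0 _]; exact: xE.
(* Differentiability is known almost everywhere on each bounded interval; countably many of them
   cover the half-line. *)
have dx (n : nat) := is_derive_bochner_primitive ip_norm (ix n.+1%:R (ler0n R _))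
  (fun t tn => xE t (proj1 (andP tn))).
move: (ae_foralln dx) (ae_neq 0); apply: ae_imply2 => t dt t_neq0 t0.
apply: (dt (Num.truncn t)).
by rewrite lt_neqAle eq_sym t_neq0 t0 truncnS_gt.
Qed.

Let solution_unique (x z : R -> H) :
  (forall b, 0 <= b -> bochner_integrable mu (`[0, b]%classic : set L) (Fx x)) ->
  (forall t, 0 <= t -> x t = x0 + I (Fx x) t) ->
  strong_solution F g x0 z -> forall t, 0 <= t -> z t = x t.
Proof.
move=> ix xE [z_0 z_ac dz] t t0.
(* The horizon [t + 1] is positive even for [t = 0], as local absolute continuity demands. *)
have b0 : 0 < t + 1 by rewrite ltr_wpDl.
have [y iy zE] := z_ac _ b0.
apply/esym/(bochner_gronwall ip_norm K_gt0 (ix _ (ltW b0)) iy).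
- by move=> u ub; rewrite (xE u) ?(zE u)//; [rewrite z_0 opprD addrACA subrr add0r|case/andP: ub].
(* The density [y] of [z] comes from absolute continuity alone; differentiating the primitive
   identifies it almost everywhere with the field along [z]. *)
- have dzy : {ae mu, forall u, 0 < u < t + 1 -> y u = F (g u) (z u)}.
    move: (is_derive_bochner_primitive ip_norm iy zE) dz.
    apply: ae_imply2 => u dy dF ub.
    have u0 : 0 <= u by apply: ltW; case/andP: ub.
    by rewrite -(@derive_val _ _ _ _ _ _ _ (dy ub)) (@derive_val _ _ _ _ _ _ _ (dF u0)).
  have dne : {ae mu, forall u, u != 0 /\ u != t + 1}.
    by move: (ae_neq 0) (ae_neq (t + 1)); apply: ae_imply2 => u.
  move: dzy dne; apply: ae_imply2 => u yF [u_neq0 u_neqb] /andP[u0 ub].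
  rewrite yF; first exact/F_lip/g_dom.
  by rewrite !lt_neqAle u0 ub u_neqb eq_sym u_neq0.
- by rewrite t0 lerDl ler01.
Qed.

Lemma caratheodory_solution : exists x, strong_solution F g x0 x /\
  forall z, strong_solution F g x0 z -> forall t, 0 <= t -> z t = x t.
Proof.
have [M F_M] := F_bounded x0.
have [x ix xE] := caratheodory_fixed_point F_M.
have x_0 : x 0 = x0 by rewrite xE// bochner_integral_point ?addr0//; exact: ix.
exists x; split; last by move=> z; exact: solution_unique.
by apply: is_solution_primitive => // t t0; rewrite x_0; exact: xE.
Qed.

End caratheodory_ode.

Theorem theorem1 (R : realType) (H : completeNormedModType R)
  (ip : {dot H for idfun}) (ip_norm : forall u : H, ip u u = `|u| ^+ 2)
  (A : H -> set H) (A_max : maximally_monotone ip A)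
  (B : H -> H) (B_mono : monotone_fun ip B)
  (beta : R) (beta_gt0 : 0 < beta) (B_lip : (beta^-1).-lipschitz B)
  (gamma : R -> R) (gamma_bd : forall t, 0 <= t -> 0 < gamma t < beta)
  (gamma_meas : measurable_fun (`[0, +oo[ : set (lebesgueType R))
                  (gamma : lebesgueType R -> R))
  (x0 : H) :
  exists x : R -> H,
    strong_solution (fbf_field A B) gamma x0 x /\
    forall z : R -> H, strong_solution (fbf_field A B) gamma x0 z ->
      forall t, 0 <= t -> z t = x t.
Proof.
apply: (caratheodory_solution ip_norm x0 beta_gt0 gamma_bd gamma_meas (ltr0n R 6)).
- by move=> c c_dom x y; exact: (fbf_field_lipschitz ip_norm A_max beta_gt0 B_lip).
- by move=> x; exact: (fbf_field_bounded ip_norm A_max beta_gt0 B_lip).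
- by move=> c x; exact: (fbf_field_param ip_norm A_max beta_gt0 B_lip).
Qed.
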